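(* Let $q$ be an odd prime power with $q \notin \{3,5,7,9,11,13,31,41\}$. Then for every $\alpha \in \mathbb{F}_{q^2}^*$ and every $\theta \in \mathbb{F}_{q^2}\setminus \mathbb{F}_q$ there exists $x \in \mathbb{F}_q$ such that $\alpha(\theta+x)$ is $2$-primitive. In particular, the least integer $L$ such that $\mathbb{F}_{q^2}/\mathbb{F}_q$ possesses the line property for $2$-primitive elements for every odd prime power $q > L$ is $L = 41$.
   Context: For a prime power $q$ and integers $n,r$ with $r \mid q^n-1$, an element of $\mathbb{F}_{q^n}^*$ is called $r$-primitive if its multiplicative order is $(q^n-1)/r$. The extension $\mathbb{F}_{q^n}/\mathbb{F}_q$ possesses the line property for $r$-primitive elements if for every $\alpha \in \mathbb{F}_{q^n}^*$ and every $\theta$ with $\mathbb{F}_{q^n} = \mathbb{F}_q(\theta)$, the set $\{\alpha(\theta+x) : x \in \mathbb{F}_q\}$ contains an $r$-primitive element. *)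

(* Defs.v *)
From HB Require Import structures.
From mathcomp Require Import all_boot all_order all_algebra all_field.

Set Implicit Arguments.
Unset Strict Implicit.
Unset Printing Implicit Defensive.

Import Order.TTheory GRing.Theory Num.Theory.
Local Open Scope ring_scope.

Definition odd_prime_power (q : nat) : Prop :=
  odd q /\ exists p k : nat, [/\ prime p, (0 < k)%N & q = (p ^ k)%N].

(* [m.-primitive_root z] says that [m] is the multiplicative order of [z];
   it entails [m > 0], hence [z != 0]. *)
Definition r_primitive (r : nat) (F : finFieldType) (E : fieldExtType F)
    (z : E) : Prop :=
  let N := (#|F| ^ \dim {:E} - 1)%N in
  (r %| N)%N /\ (N %/ r)%N.-primitive_root z.

Definition line_property (r : nat) (F : finFieldType) (E : fieldExtType F) :
    Prop :=
  forall alpha theta : E,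
    alpha != 0 -> <<1; theta>>%VS = {:E}%VS ->
    exists x : F, r_primitive r (alpha * (theta + x%:A)).

(* Finite fields being unique up to isomorphism, "F_{q^2}/F_q" is rendered as
   an arbitrary extension of degree 2 of an arbitrary field with q elements. *)
Definition quadratic_line_property_beyond (r : nat) (L : int) : Prop :=
  forall q : nat, odd_prime_power q -> L < q%:Z ->
  forall (F : finFieldType) (E : fieldExtType F),
    #|F| = q -> \dim {:E} = 2%N -> line_property r E.

(* Main.v *)
(** Let [g] generate the multiplicative group of the field [K] with [q ^ 2]
    elements and put [n = q ^ 2 - 1]. The element [g ^+ s] is 2-primitive iff
    [s = 2 %[mod 4]] and no odd prime divisor of [n] divides [s].

    A nontrivial character of [K^*] summed over a line has absolute value
    [sqrt q], or [1] if it is trivial on the small field: expanding the square,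
    the quotients [(theta + x) / (theta + y)] with [x <> y] run exactly once
    through the elements outside the small field. Expanding the above conditions
    on [s] in characters, at the primes of a core only and with a union bound at
    the others, yields a sieve inequality on [q] that guarantees a 2-primitive
    element on every line. It holds for [q > 121 ^ 2], because [8] times the
    product of the odd prime divisors of [n] is less than [q ^ 2], and it is
    evaluated for each prime power [q <= 121 ^ 2]; 106 of them fail it.

    For these, take [g] with [g ^+ 2 = g - w] where [w] generates [F^*], with [F]
    the small field. Multiplication by powers of [g] is transitive on the lines,
    so it suffices to know the set [D] of logarithms of the line [g + F]: one
    needs that every translate of [D] contains an admissible [s]. Writing
    [g ^+ i.+1 = - w b_i + b_{i+1} g], the set [D] is read off the logarithms to
    base [w = g ^+ q.+1] of the [b_i]. For [q = 41] the translate of [D] by 168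
    contains no admissible [s]. *)

Require Import Defs.
From HB Require Import structures.
From Stdlib Require Import PArith NArith FMapPositive.
From mathcomp Require Import all_boot all_order all_algebra all_fingroup.
From mathcomp Require Import all_solvable all_field zify ring.

Set Implicit Arguments.
Unset Strict Implicit.
Unset Printing Implicit Defensive.

Import Order.TTheory GRing.Theory Num.Theory.
Local Open Scope ring_scope.

(** * Generators of finite fields, and the numerical quantities of the sieve *)

Lemma finField_prim_root (K : finFieldType) : {g : K | #|K|.-1.-primitive_root g}.
Proof.
have K1 : (0 < #|K|.-1)%N by rewrite -subn1 subn_gt0 finNzRing_gt1.
apply/sigW; have := @has_prim_root _ _ [seq x <- enum K | x != 0] K1.
case/(_ _ _ _)/hasP; last by move=> g _; exists g.
- apply/allP=> x; rewrite mem_filter unity_rootE => /andP[x0 _].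
  by apply/eqP/(mulfI x0); rewrite -exprS prednK ?expf_card ?mulr1 // ltnW ?finNzRing_gt1.
- by rewrite filter_uniq ?enum_uniq.
rewrite size_filter (cardE K) -(count_predC (pred1 0)) count_uniq_mem ?enum_uniq //.
by rewrite mem_enum inE add1n.
Qed.

Definition odd_prime_divisor (q p : nat) : bool :=
  [&& prime p, odd p & p %| q ^ 2 - 1]%N.

(** The sum of the absolute values of the coefficients of [core_trig C]: the condition modulo 4
    contributes 4 and each prime contributes 2. In [core_triv] only the characters trivial on the
    small field are counted. *)
Definition core_size (C : seq nat) : nat := (4 * 2 ^ size C)%N.
Definition core_triv (q : nat) (C : seq nat) : nat :=
  ((if 4 %| q.+1 then 4 else 2) * 2 ^ count (fun p => p %| q.+1) C)%N.

Definition hits (C : seq nat) (s : nat) : bool :=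
  (4 %| s + 2)%N && all (fun p => ~~ (p %| s)%N) C.

(* [\prod_(p <- S) p] times [\sum_(p <- S) 1 / p]. *)
Fixpoint sieve_den (S : seq nat) : nat :=
  if S is p :: S' then (\prod_(p <- S') p + p * sieve_den S')%N else 0%N.

(** Bounds the line sum of one character of order [p] times the core polynomial. If [p] divides
    [q + 1], that character is trivial on the small field, so a part [U] of the weight [T] costs 1
    instead of [r]; otherwise no product is trivial there. *)
Definition sieve_cost (q T U r p : nat) : nat :=
  (if p %| q.+1 then (T - U) * r + U else T * r)%N.

(* [\prod_(p <- S) p] times [\sum_(p <- S) (1 - 1 / p) * sieve_cost q T U r p]. *)
Fixpoint sieve_err (q T U r : nat) (S : seq nat) : nat :=
  if S is p :: S' then
    (p.-1 * sieve_cost q T U r p * \prod_(p <- S') p + p * sieve_err q T U r S')%N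
  else 0%N.

Lemma core_triv_le q C : (0 < core_triv q C <= core_size C)%N.
Proof.
rewrite /core_triv /core_size muln_gt0 expn_gt0 /= andbT; case: ifP => _ /=;
by rewrite leq_mul // leq_exp2l // count_size.
Qed.

Lemma coprime_prod p C :
  odd p -> prime p -> all prime C -> p \notin C -> coprime p (4 * \prod_(c <- C) c).
Proof.
move=> op pp aC pC; rewrite coprimeMr (_ : 4 = 2 ^ 2)%N // coprimeXr ?coprimen2 //=.
elim: C aC pC => [|c C IH] /=; first by rewrite big_nil coprimen1.
case/andP=> cp aC; rewrite inE negb_or => /andP[pc pC].
by rewrite big_cons coprimeMr prime_coprime // dvdn_prime2 // pc IH.
Qed.

(** * Character sums over lines *)

Section QuadraticExtension.

Variables (F K : finFieldType) (emb : {rmorphism F -> K}).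
Hypothesis cardK : #|K| = (#|F| ^ 2)%N.
Local Notation q := #|F|.
Local Notation n := (#|F| ^ 2 - 1)%N.

Lemma q_gt1 : (1 < q)%N. Proof. exact: finNzRing_gt1. Qed.

Lemma orderE : n = ((q - 1) * (q + 1))%N.
Proof. by rewrite -{2}(exp1n 2) -subn_sqr. Qed.

Lemma order_gt0 : (0 < n)%N.
Proof. by rewrite orderE muln_gt0 subn_gt0 q_gt1 addn1. Qed.

Lemma dvdn_order : (q - 1 %| n)%N. Proof. by rewrite orderE dvdn_mulr. Qed.

Variable g : K.
Hypothesis prim_g : n.-primitive_root g.

Lemma expf_order (z : K) : z != 0 -> z ^+ n = 1.
Proof.
move=> z0; apply: (mulfI z0); rewrite -exprS mulr1 -cardK subn1 prednK ?expf_card //.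
by rewrite cardK expn_gt0 (ltnW q_gt1).
Qed.

Lemma gen_neq0 : g != 0.
Proof.
apply/eqP=> g0; have := prim_expr_order prim_g.
by rewrite g0 expr0n gtn_eqF ?order_gt0 // => /eqP; rewrite eq_sym oner_eq0.
Qed.

(** Zero is not in the list, so [dlog 0] is the default value [n]. *)
Definition dlog (z : K) : nat := index z [seq g ^+ i | i <- iota 0 n].

Lemma dlogK z : z != 0 -> g ^+ dlog z = z.
Proof.
move=> z0; have [i zE] := prim_rootP prim_g (expf_order z0).
have zin : z \in [seq g ^+ i | i <- iota 0 n].
  by rewrite zE; apply/map_f; rewrite mem_iota /= add0n.
have := nth_index 0 zin; rewrite (nth_map 0%N) ?nth_iota ?add0n //.
  by have := zin; rewrite -index_mem size_map size_iota.
by have := zin; rewrite -index_mem size_map.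
Qed.

Lemma codom_emb z : z ^+ (q - 1) = 1 -> exists x, z = emb x.
Proof.
have [a pa] := finField_prim_root F; rewrite subn1.
move=> zq; have pea : q.-1.-primitive_root (emb a) by rewrite fmorph_primitive_root.
by have [i ->] := prim_rootP pea zq; exists (a ^+ i); rewrite rmorphXn.
Qed.

Variable theta : K.
Hypothesis theta_out : forall x, theta != emb x.

Lemma line_neq0 x : theta + emb x != 0.
Proof. by rewrite addr_eq0 -rmorphN theta_out. Qed.

Lemma line_coords_inj : injective (fun ab : F * F => emb ab.1 * theta + emb ab.2).
Proof.
move=> [a b] [c d] /= e.
have [ac|ac] := eqVneq a c.
  by move: e; rewrite ac => /addrI/fmorph_inj ->.
have E : emb (a - c) * theta = emb (d - b).
  rewrite !rmorphB mulrBl; apply/eqP; rewrite subr_eq addrAC eq_sym subr_eq eq_sym.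
  by rewrite e addrC.
have ac0 : emb (a - c) != 0 by rewrite fmorph_eq0 subr_eq0.
case/eqP: (theta_out ((a - c)^-1 * (d - b))).
by rewrite rmorphM -E fmorphV mulrA mulVf ?mul1r.
Qed.

Lemma line_coords_bij : bijective (fun ab : F * F => emb ab.1 * theta + emb ab.2).
Proof. by apply: inj_card_bij; [exact: line_coords_inj | rewrite card_prod cardK]. Qed.

Lemma line_coords z : exists ab : F * F, z = emb ab.1 * theta + emb ab.2.
Proof. by have [h _ hK] := line_coords_bij; exists (h z); rewrite hK. Qed.

Variable zeta : algC.
Hypothesis prim_zeta : n.-primitive_root zeta.

(** The character of [K^*] that sends [g] to [zeta], extended by 0. Its powers are all the
    characters, and the positive ones still vanish at 0. *)
Definition psi (z : K) : algC := if z == 0 then 0 else zeta ^+ dlog z.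

Lemma psi_gen i : psi (g ^+ i) = zeta ^+ i.
Proof.
rewrite /psi expf_eq0 (negPf gen_neq0) andbF.
apply/eqP; rewrite (eq_prim_root_expr prim_zeta) -(eq_prim_root_expr prim_g).
by rewrite dlogK ?expf_neq0 ?gen_neq0.
Qed.

Lemma psi0 : psi 0 = 0. Proof. by rewrite /psi eqxx. Qed.

Lemma psi1 : psi 1 = 1. Proof. by rewrite -(expr0 g) psi_gen. Qed.

Lemma psiM : {morph psi : x y / x * y}.
Proof.
move=> x y; have [->|x0] := eqVneq x 0; first by rewrite mul0r psi0 mul0r.
have [->|y0] := eqVneq y 0; first by rewrite mulr0 psi0 mulr0.
by rewrite -(dlogK x0) -(dlogK y0) -exprD !psi_gen exprD.
Qed.

Lemma psi_neq0 z : z != 0 -> psi z != 0.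
Proof.
move=> z0; rewrite -(dlogK z0) psi_gen expf_neq0 // (prim_root_eq0 prim_zeta).
by rewrite -lt0n order_gt0.
Qed.

Lemma norm_psi z : z != 0 -> `|psi z| = 1.
Proof.
move=> z0; have : `|psi z| ^+ n == 1.
  rewrite -normrX -(dlogK z0) psi_gen -exprM mulnC exprM.
  by rewrite (prim_expr_order prim_zeta) expr1n normr1.
by rewrite pexpr_eq1 ?order_gt0 // => /eqP.
Qed.

Lemma conj_psi z : (psi z)^* = psi z^-1.
Proof.
have [->|z0] := eqVneq z 0; first by rewrite invr0 psi0 conjC0.
apply: (mulfI (psi_neq0 z0)); rewrite -normCK norm_psi // expr1n.
by rewrite -psiM mulfV // psi1.
Qed.

Section NontrivialCharacter.

Variable k : nat.
Hypothesis k_gt0 : (0 < k)%N.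
Hypothesis k_nontriv : ~~ (n %| k)%N.
Let chi z := psi z ^+ k.

Lemma chiM : {morph chi : x y / x * y}.
Proof. by move=> x y; rewrite /chi psiM exprMn. Qed.

Lemma sum_chi : \sum_z chi z = 0.
Proof.
have cg : chi g != 1.
  by rewrite /chi -(expr1 g) psi_gen expr1 -(prim_order_dvd prim_zeta).
have: \sum_z chi z = chi g * \sum_z chi z.
  rewrite mulr_sumr (reindex_inj (mulfI gen_neq0)) /=.
  by apply: eq_bigr => z _; rewrite chiM.
move/eqP; rewrite -subr_eq0 -{1}[\sum_z _]mul1r -mulrBl mulf_eq0 subr_eq0.
by rewrite eq_sym (negPf cg) => /eqP.
Qed.

(** [g ^+ q.+1] generates [F^*], so [chi] is trivial there exactly when [q - 1] divides [k].
    Otherwise shifting by this generator multiplies the sum by a factor other than 1. *)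
Lemma sum_chi_emb :
  \sum_x chi (emb x) = if (q - 1 %| k)%N then (q - 1)%:R else 0.
Proof.
have q1 := q_gt1.
have chi_e x : x != 0 -> exists m, emb x = g ^+ (q.+1 * m).
  move=> x0; have ex0 : emb x != 0 by rewrite fmorph_eq0.
  have pg : (q - 1)%N.-primitive_root (g ^+ q.+1).
    have := exp_prim_root prim_g q.+1.
    rewrite (_ : gcdn q.+1 n = q.+1) ?orderE ?addn1 ?mulnK //.
    exact: gcdnMl.
  have xq : emb x ^+ (q - 1) = 1.
    rewrite -rmorphXn (_ : x ^+ (q - 1) = 1) ?rmorph1 //; apply: (mulfI x0).
    by rewrite -exprS mulr1 subn1 prednK ?expf_card // ltnW.
  by have [i ->] := prim_rootP pg xq; exists i; rewrite exprM.
case: ifP => dk.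
  rewrite (bigD1 0) //= rmorph0 /chi psi0 expr0n gtn_eqF // add0r.
  rewrite (eq_bigr (fun _ => 1)) => [|x x0].
    rewrite sumr_const; congr (_%:R).
    by rewrite (eq_card (B := predC1 0)) ?cardC1 ?subn1.
  have [m ->] := chi_e x x0; rewrite psi_gen -exprM.
  apply/eqP; rewrite -(prim_order_dvd prim_zeta) orderE addn1.
  have [l ->] := dvdnP dk; rewrite [(l * _)%N]mulnC mulnA dvdn_mulr //.
  by rewrite mulnAC mulnC dvdn_mulr // mulnC.
have [a aE] : exists a, g ^+ q.+1 = emb a.
  apply: codom_emb; rewrite -exprM; apply/eqP.
  by rewrite -(prim_order_dvd prim_g) orderE addn1 mulnC.
have a0 : a != 0.
  apply/eqP=> a0; move/eqP: aE; rewrite a0 rmorph0 expf_eq0 /=.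
  by rewrite (negPf gen_neq0).
have ca : chi (emb a) != 1.
  rewrite -aE /chi psi_gen -exprM -(prim_order_dvd prim_zeta) orderE addn1 mulnC.
  by rewrite dvdn_pmul2l // dk.
have: \sum_x chi (emb x) = chi (emb a) * \sum_x chi (emb x).
  rewrite mulr_sumr (reindex_inj (mulfI a0)) /=.
  by apply: eq_bigr => z _; rewrite rmorphM chiM.
move/eqP; rewrite -subr_eq0 -{1}[\sum_x _]mul1r -mulrBl mulf_eq0 subr_eq0.
by rewrite eq_sym (negPf ca) => /eqP.
Qed.

(** The diagonal of the expanded square contributes [q]. As [chi] sums to 0 over [K], the remaining
    terms contribute minus its sum over the small field, which is [q - 1] or 0. *)
Lemma norm_line_sum :
  `|\sum_x chi (theta + emb x)| ^+ 2 = if (q - 1 %| k)%N then 1 else q%:R.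
Proof.
have q1 := q_gt1.
(* For [c != 0] the quotient [(theta + y + c) / (theta + y)] is [1 + u^-1] with
   [u = (theta + y) / c], and [u] runs once through the elements [a * theta + b] with [a != 0]. With
   [0^-1 = 0], inversion permutes the whole field. *)
pose phi u := chi (1 + u^-1).
have inv_inj (L : fieldType) : injective (@GRing.inv L) by exact: invr_inj.
have sumphi : \sum_u phi u = 0.
  rewrite -[RHS]sum_chi (reindex_inj (@inv_inj K)) /= [RHS](reindex_inj (addrI 1)) /=.
  by apply: eq_bigr => u _; rewrite /phi invrK.
have sumphiF : \sum_b phi (emb b) = \sum_x chi (emb x).
  rewrite (reindex_inj (@inv_inj F)) /= [RHS](reindex_inj (addrI 1)) /=.
  by apply: eq_bigr => u _; rewrite /phi fmorphV invrK rmorphD rmorph1.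
have sumoff : \sum_(a | a != 0) \sum_b phi (emb a * theta + emb b) =
              - \sum_x chi (emb x).
  apply/eqP; rewrite -addr_eq0 -sumphiF addrC -[X in _ == X]sumphi.
  rewrite (reindex _ (onW_bij _ line_coords_bij)) /=.
  rewrite -(pair_bigA _ (fun a b => phi (emb a * theta + emb b))) /=.
  rewrite [X in _ == X](bigD1 0) //= rmorph0.
  by under [X in _ == X + _]eq_bigr do rewrite mul0r add0r.
rewrite normCK rmorph_sum /= mulr_sumr.
transitivity (\sum_y \sum_c chi (1 + emb c * (theta + emb y)^-1)).
  apply: eq_bigr => y _; rewrite mulr_suml (reindex_inj (addrI y)) /=.
  apply: eq_bigr => c _; rewrite rmorphXn /= conj_psi -exprMn -psiM.
  by rewrite rmorphD addrA mulrDl mulfV ?line_neq0.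
rewrite exchange_big (bigD1 0) //=.
under eq_bigr do rewrite rmorph0 mul0r addr0 /chi psi1 expr1n.
rewrite sumr_const.
rewrite (_ : \sum_(_ | _) _ = - \sum_x chi (emb x)); last first.
  rewrite -sumoff (reindex_inj (@inv_inj F)) /=.
  apply: eq_big => [c|c c0]; first by rewrite invr_eq0.
  have ec : emb c != 0 by rewrite fmorph_eq0 -invr_eq0.
  have ci0 : c^-1 != 0 by [].
  rewrite (reindex_inj (mulfI ci0)) /=.
  apply: eq_bigr => b _; rewrite /phi; congr (chi (1 + _)).
  rewrite rmorphM fmorphV -invfM; congr (_^-1).
  by rewrite mulrDr mulrA mulfV // mul1r.
rewrite sum_chi_emb; case: ifP => _; last by rewrite oppr0 addr0.
by rewrite -natrB ?leq_subr // subKn // ltnW.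
Qed.

End NontrivialCharacter.

(** * The sieve *)

(** A pair [(c, k)] stands for the term [c * psi ^+ k]. Exponents may repeat and are not reduced
    modulo [n]. *)
Definition trig_poly := seq (algC * nat).

Definition trig_eval (P : trig_poly) (z : K) : algC :=
  \sum_(t <- P) t.1 * psi z ^+ t.2.

Definition trig_mul (P Q : trig_poly) : trig_poly :=
  [seq (s.1 * t.1, (s.2 + t.2)%N) | s <- P, t <- Q].

Lemma trig_eval_mul P Q z :
  trig_eval (trig_mul P Q) z = trig_eval P z * trig_eval Q z.
Proof.
rewrite /trig_eval big_allpairs_dep mulr_suml; apply: eq_bigr => s _.
by rewrite mulr_sumr; apply: eq_bigr => t _ /=; rewrite exprD mulrACA.
Qed.

(* Only the characters that are trivial on the subgroup of order [d] count:
   [d = n] leaves the trivial character, [d = q - 1] the characters that are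
   trivial on the small field, [d = 1] all of them. *)
Definition trig_sum (w : algC -> algC) (d : nat) (P : trig_poly) : algC :=
  \sum_(t <- P | (d %| t.2)%N) w t.1.

Definition trig_supp (m : nat) (P : trig_poly) : bool :=
  all (fun t => n %| m * t.2)%N P.

Lemma trig_supp_mul m m' P Q :
  trig_supp m P -> trig_supp m' Q -> trig_supp (m * m') (trig_mul P Q).
Proof.
move=> /allP sP /allP sQ; apply/allP=> _ /allpairsP[[s t] /= [sin tin ->]] /=.
rewrite mulnDr dvdn_add //; first by rewrite [(m * m')%N]mulnC -mulnA dvdn_mull ?(sP s).
by rewrite -mulnA dvdn_mull ?(sQ t).
Qed.

(** For coprime orders a product is trivial on a subgroup only if both factors are: if [d] divides
    [k + l] and [m * k], it divides [m * l]; it also divides [m' * l], hence [l]. So the sum over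
    products factors. *)
Lemma trig_sum_mul w d m m' P Q :
  {morph w : x y / x * y} -> (d %| n)%N -> coprime m m' ->
  trig_supp m P -> trig_supp m' Q ->
  trig_sum w d (trig_mul P Q) = trig_sum w d P * trig_sum w d Q.
Proof.
move=> wM dn cmm /allP sP /allP sQ.
rewrite /trig_sum big_mkcond big_allpairs_dep mulr_suml [RHS]big_mkcond /=.
apply: eq_big_seq => s sin; rewrite mulr_sumr [in RHS]big_mkcond /=.
have dvd_sum k l : (d %| m * k -> d %| m' * l -> (d %| k + l) = (d %| k) && (d %| l))%N.
  move=> mk ml; apply/idP/andP => [kl|[]]; last exact: dvdn_add.
  have mk' : (d %| m * l)%N.
    by rewrite -(dvdn_addr _ mk) -mulnDr dvdn_mull.
  have l1 : (d %| l)%N.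
    have : (d %| gcdn (m * l) (m' * l))%N by rewrite dvdn_gcd mk' ml.
    by rewrite -muln_gcdl (eqP cmm) mul1n.
  by split=> //; rewrite -(dvdn_addl _ l1).
have sd := dvdn_trans dn (sP s sin).
case: ifP => ds.
  apply: eq_big_seq => t tin /=.
  rewrite (dvd_sum _ _ sd (dvdn_trans dn (sQ t tin))) ds /=.
  by case: ifP; rewrite ?mulr0 ?wM.
rewrite big1_seq // => t /= tin.
by rewrite (dvd_sum _ _ sd (dvdn_trans dn (sQ t tin))) ds.
Qed.

(** The trivial character contributes [q] times its coefficient. Any other contributes at most the
    absolute value of its coefficient, times [r] unless it is trivial on the small field; the factor
    coming from [alpha] has absolute value 1. *)
Lemma line_trig_bound P alpha r :
    alpha != 0 -> (q <= r ^ 2)%N ->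
  `|\sum_x trig_eval P (alpha * (theta + emb x)) - q%:R * trig_sum id n P|
  <= (trig_sum Num.norm (q - 1) P - trig_sum Num.norm n P)
     + (trig_sum Num.norm 1 P - trig_sum Num.norm (q - 1) P) * r%:R.
Proof.
move=> a0 qr; rewrite /trig_eval /trig_sum exchange_big /= mulr_sumr.
rewrite [X in _ - X]big_mkcond -sumrB.
rewrite (big_mkcond (fun t => q - 1 %| t.2)%N) (big_mkcond (fun t => n %| t.2)%N).
rewrite (big_mkcond (fun t => 1 %| t.2)%N) -!sumrB mulr_suml -big_split /=.
apply: le_trans (ler_norm_sum _ _ _) _; apply: ler_sum => -[c k] _ /=.
rewrite dvd1n -mulr_sumr; have [nk|nk] := boolP (n %| k)%N.
  rewrite (dvdn_trans dvdn_order nk) !subrr mul0r addr0.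
  rewrite (eq_bigr (fun _ => 1)) => [|x _].
    by rewrite sumr_const mulrC subrr normr0.
  rewrite -[_ * _]dlogK ?mulf_neq0 ?line_neq0 // psi_gen -exprM mulnC exprM.
  by move: nk; rewrite (prim_order_dvd prim_zeta) => /eqP->; rewrite expr1n.
have k0 : (0 < k)%N by rewrite lt0n; apply: contra nk => /eqP->; rewrite dvdn0.
rewrite subr0 normrM.
have -> : `|\sum_x psi (alpha * (theta + emb x)) ^+ k| =
          `|\sum_x psi (theta + emb x) ^+ k|.
  under eq_bigr do rewrite psiM exprMn.
  by rewrite -mulr_sumr normrM normrX norm_psi // expr1n mul1r.
have := norm_line_sum k0 nk.
case: ifP => dk S2; rewrite !subr0 ?subrr ?mul0r ?addr0 ?add0r.
  rewrite ler_piMr //; move/eqP: S2.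
  by rewrite sqrp_eq1 // => /eqP ->.
rewrite ler_wpM2l // -(ler_pXn2r (n := 2)) ?nnegrE // S2 -natrX ler_nat.
exact: qr.
Qed.

(** * Polynomials in the characters of order dividing [m] *)

Section RootOfUnityPolynomials.

Variable m : nat.
Hypothesis m_gt0 : (0 < m)%N.
Hypothesis m_dvd : (m %| n)%N.

Definition trig_geom (a : nat -> algC) : trig_poly :=
  [seq (a j, (j * (n %/ m))%N) | j <- iota 0 m].

Lemma trig_geom_supp a : trig_supp m (trig_geom a).
Proof.
apply/allP=> _ /mapP[j _ ->] /=.
by rewrite mulnCA [(m * _)%N]mulnC divnK // dvdn_mull.
Qed.

Lemma trig_geom_sum1 w a : trig_sum w 1 (trig_geom a) = \sum_(j < m) w (a j).
Proof.
rewrite /trig_sum big_map -(big_mkord xpredT (fun j => w (a j))) /index_iota subn0.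
by apply: eq_bigl => j; rewrite dvd1n.
Qed.

Lemma trig_geom_sumn w a : trig_sum w n (trig_geom a) = w (a 0%N).
Proof.
rewrite /trig_sum big_map big_mkcond /=.
rewrite (eq_big_seq (fun j => if j == 0%N then w (a j) else 0)) => [|j]; last first.
  rewrite mem_iota add0n /= => jm.
  rewrite -{1}(divnK m_dvd) mulnC dvdn_pmul2r; last first.
    by rewrite divn_gt0 // dvdn_leq ?order_gt0.
  case: (posnP j) => [->|j0]; first by rewrite dvdn0.
  by rewrite gtnNdvd // gtn_eqF.
case: m m_gt0 => // m' _ /=; rewrite big_cons /= big1_seq ?addr0 // => j /=.
by rewrite mem_iota => /andP[j1 _]; rewrite gtn_eqF.
Qed.

(** As [n = (q - 1) * (q + 1)], the exponent [j * (n %/ m)] is a multiple of [q - 1] exactly when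
    [m] divides [j * (q + 1)]. *)
Lemma trig_geom_sumq w a :
  trig_sum w (q - 1) (trig_geom a) = \sum_(j < m | (m %| j * q.+1)%N) w (a j).
Proof.
have q10 : (0 < q - 1)%N by rewrite subn_gt0 q_gt1.
rewrite /trig_sum big_map -(big_mkord (fun j => m %| j * q.+1)%N (fun j => w (a j))).
rewrite /index_iota subn0; apply: eq_bigl => j /=.
rewrite -(dvdn_pmul2r m_gt0) -mulnA divnK // orderE addn1 mulnCA dvdn_pmul2l //.
Qed.

Lemma trig_geom_eval a z : z != 0 ->
  trig_eval (trig_geom a) z = \sum_(j < m) a j * (zeta ^+ (n %/ m)) ^+ (j * dlog z).
Proof.
move=> z0; rewrite /trig_eval big_map.
rewrite -(big_mkord xpredT (fun j => a j * (zeta ^+ (n %/ m)) ^+ (j * dlog z))) /index_iota subn0.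
apply: eq_bigr => j _ /=; rewrite -[in LHS](dlogK z0) psi_gen -!exprM.
by congr (_ * _ ^+ _); rewrite mulnC mulnCA mulnA.
Qed.

Lemma prim_root_quot : m.-primitive_root (zeta ^+ (n %/ m)).
Proof.
have := exp_prim_root prim_zeta (n %/ m).
have d0 : (0 < n %/ m)%N by rewrite divn_gt0 // dvdn_leq ?order_gt0.
have -> : gcdn (n %/ m) n = (n %/ m)%N.
  by rewrite -{2}(divnK m_dvd) mulnC gcdnMl.
by rewrite -{1}(divnK m_dvd) mulKn.
Qed.

Lemma sum_root_of_unity s :
  \sum_(j < m) (zeta ^+ (n %/ m)) ^+ (j * s) = if (m %| s)%N then m%:R else 0.
Proof.
have pw := prim_root_quot; set om := zeta ^+ _ in pw *.
under eq_bigr do rewrite mulnC exprM.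
case: ifP => ms.
  have -> : om ^+ s = 1 by apply/eqP; rewrite -(prim_order_dvd pw).
  by under eq_bigr do rewrite expr1n; rewrite sumr_const card_ord.
have os : om ^+ s != 1 by rewrite -(prim_order_dvd pw) ms.
have /eqP := subrX1 (om ^+ s) m.
rewrite -exprM mulnC exprM (prim_expr_order pw) expr1n subrr eq_sym mulf_eq0 subr_eq0.
by rewrite (negPf os) => /eqP.
Qed.

(* Normalized to have mean 1. *)
Definition coprime_trig : trig_poly :=
  trig_geom (fun j => if j == 0%N then 1 else - (m.-1%:R)^-1).

Lemma coprime_trig_eval z : z != 0 -> (1 < m)%N ->
  trig_eval coprime_trig z = if (m %| dlog z)%N then 0 else m%:R / m.-1%:R.
Proof.
move=> z0 m1; rewrite trig_geom_eval //.
have /esym := sum_root_of_unity (dlog z).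
case: m m1 => [|[|m']] //= _; rewrite big_ord_recl mul0n expr0 => sE.
rewrite big_ord_recl /= mul1r mul0n expr0.
rewrite (eq_bigr (fun j : 'I_m'.+1 => - (m'.+1%:R)^-1 *
  (zeta ^+ (n %/ m'.+2)) ^+ (lift ord0 j * dlog z))) //.
rewrite -mulr_sumr; move/eqP: sE; rewrite addrC -subr_eq => /eqP <-.
have m0 : m'.+1%:R != 0 :> algC by rewrite pnatr_eq0.
case: ifP => _; last by rewrite sub0r mulrN1 opprK -[m'.+2%:R]natr1 mulrDl mulfV // mul1r.
by rewrite -[m'.+2%:R]natr1 addrK mulNr mulVf // subrr.
Qed.

Definition residue_trig (u : nat) : trig_poly :=
  trig_geom (fun j => (zeta ^+ (n %/ m)) ^+ (j * u)).

Lemma residue_trig_eval u z : z != 0 ->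
  trig_eval (residue_trig u) z = if (m %| dlog z + u)%N then m%:R else 0.
Proof.
move=> z0; rewrite trig_geom_eval // -sum_root_of_unity.
by apply: eq_bigr => j _; rewrite -exprD -mulnDr addnC.
Qed.

(** Detects the logarithms divisible by [m]. The trivial character is left out, so that its line
    sums are pure error. *)
Definition multiple_trig : trig_poly := trig_geom (fun j => (j != 0%N)%:R).

Lemma multiple_trig_eval z : z != 0 ->
  trig_eval multiple_trig z = (if (m %| dlog z)%N then m%:R else 0) - 1.
Proof.
move=> z0; rewrite trig_geom_eval // -sum_root_of_unity.
case: m m_gt0 => // m' _; rewrite !big_ord_recl /= mul0r add0r mul0n expr0 addrAC subrr add0r.
by apply: eq_bigr => j _; rewrite mul1r.
Qed.

End RootOfUnityPolynomials.
(** The nontrivial characters of prime order [p] are trivial on the small field either all together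
    or not at all. *)
Lemma trig_geom_sumq_prime p w a : prime p -> (p %| n)%N ->
  trig_sum w (q - 1) (trig_geom p a) =
  if (p %| q.+1)%N then trig_sum w 1 (trig_geom p a)
  else trig_sum w n (trig_geom p a).
Proof.
move=> pp pn; have p0 := prime_gt0 pp.
rewrite trig_geom_sumq // trig_geom_sum1 trig_geom_sumn //.
case: ifP => pq; first by apply: eq_bigl => j; rewrite dvdn_mull.
rewrite (big_pred1 (Ordinal p0)) //= => j; rewrite Euclid_dvdM // pq orbF.
case: (posnP j) => [j0|j0]; first by rewrite j0 dvdn0; apply/esym/eqP/val_inj.
by rewrite gtnNdvd //; apply/esym/negbTE/eqP => jE; move: j0; rewrite jE.
Qed.

Section Sieve.

Hypothesis q_odd : odd q.

Lemma dvd4_order : (4 %| n)%N.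
Proof.
rewrite orderE (_ : 4 = 2 * 2)%N // dvdn_mul // dvdn2 ?oddB ?q_odd //.
  exact: ltnW q_gt1.
by rewrite oddD q_odd.
Qed.

Lemma coprime_trig_sum1 p : prime p -> trig_sum Num.norm 1 (coprime_trig p) = 2.
Proof.
move=> pp; rewrite trig_geom_sum1; case: p pp => [|[|p]] // _.
rewrite big_ord_recl /= normr1.
rewrite (eq_bigr (fun _ => (p.+1%:R)^-1)) => [|j _]; last first.
  by rewrite normrN ger0_norm // invr_ge0 ler0n.
by rewrite sumr_const card_ord -[_ *+ p.+1]mulr_natr mulVf ?pnatr_eq0.
Qed.

Lemma residue4_trig_sum1 : trig_sum Num.norm 1 (residue_trig 4 2) = 4.
Proof.
have z1 : `|zeta| = 1.
  by rewrite -(expr1 zeta) -psi_gen norm_psi // expr1 gen_neq0.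
rewrite trig_geom_sum1 (eq_bigr (fun _ => 1)) => [|j _].
  by rewrite sumr_const card_ord.
by rewrite !normrX z1 !expr1n.
Qed.

(** As [q] is odd, the quadratic character is always trivial on the small field; the two characters
    of order 4 are so only if 4 divides [q + 1]. *)
Lemma residue4_trig_sumq :
  trig_sum Num.norm (q - 1) (residue_trig 4 2) = (if 4 %| q.+1 then 4 else 2)%N%:R.
Proof.
have z1 : `|zeta| = 1.
  by rewrite -(expr1 zeta) -psi_gen norm_psi // expr1 gen_neq0.
rewrite trig_geom_sumq ?dvd4_order //.
rewrite (eq_bigr (fun _ => 1)) => [|j _]; last by rewrite !normrX z1 !expr1n.
rewrite big_mkcond !big_ord_recl big_ord0 /= /bump /= !addn0 mul1n.
have -> : (4 %| (1 + 1) * q.+1)%N by move: q_odd; rewrite /dvdn; lia.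
have -> : (4 %| (1 + (1 + 1)) * q.+1)%N = (4 %| q.+1)%N by rewrite /dvdn; lia.
by case: ifP => _; rewrite ?add0r !addr0 // !addrA.
Qed.

Definition core_trig (C : seq nat) : trig_poly :=
  foldr (fun p => trig_mul (coprime_trig p)) (residue_trig 4 2) C.

(** The factors involve characters of coprime orders, so each sum is the product of the sums of the
    factors. *)
Lemma core_trig_sums C : all (odd_prime_divisor q) C -> uniq C ->
  [/\ trig_supp (4 * \prod_(p <- C) p) (core_trig C),
      trig_sum id n (core_trig C) = 1,
      trig_sum Num.norm n (core_trig C) = 1,
      trig_sum Num.norm 1 (core_trig C) = (core_size C)%:R
    & trig_sum Num.norm (q - 1) (core_trig C) = (core_triv q C)%:R].
Proof.
elim: C => [|p C IH] /=.
  move=> _ _; rewrite /core_size /core_triv /= expn0 !muln1 big_nil muln1.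
  rewrite residue4_trig_sum1 residue4_trig_sumq.
  by split=> //; [exact: trig_geom_supp dvd4_order _ | rewrite trig_geom_sumn ?dvd4_order..];
    rewrite ?mul0n ?expr0 ?normr1.
case/andP=> /and3P[pp op pn] aC /andP[pC uC].
have [sC aCn nCn nC1 nCq] := IH aC uC.
have p0 := prime_gt0 pp.
have sp := trig_geom_supp pn (fun j => if j == 0%N then 1 else - (p.-1%:R)^-1).
have cop : coprime p (4 * \prod_(p <- C) p).
  by apply: coprime_prod => //; apply: sub_all aC => c /and3P[].
split.
- by rewrite big_cons mulnCA trig_supp_mul.
- by rewrite (trig_sum_mul _ _ cop) // aCn trig_geom_sumn // mulr1.
- by rewrite (trig_sum_mul (@normrM _) _ cop) // nCn trig_geom_sumn // normr1 mulr1.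
- rewrite (trig_sum_mul (@normrM _) (dvd1n _) cop) // nC1 coprime_trig_sum1 //.
  by rewrite -natrM /core_size /= expnS mulnCA.
rewrite (trig_sum_mul (@normrM _) dvdn_order cop) // nCq trig_geom_sumq_prime //.
rewrite /core_triv /=; case: (p %| q.+1)%N; last by rewrite trig_geom_sumn // normr1 mul1r.
by rewrite coprime_trig_sum1 // -natrM add1n expnS mulnCA.
Qed.

Definition core_value (C : seq nat) : algC := 4 * \prod_(p <- C) (p%:R / p.-1%:R).

Lemma core_trig_eval C z : all (odd_prime_divisor q) C -> z != 0 ->
  trig_eval (core_trig C) z = if hits C (dlog z) then core_value C else 0.
Proof.
move=> + z0; elim: C => [|p C IH] /=.
  by rewrite residue_trig_eval ?dvd4_order // /hits andbT /core_value big_nil mulr1.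
case/andP=> /and3P[pp op pn] aC; rewrite trig_eval_mul IH //.
rewrite coprime_trig_eval ?prime_gt0 ?prime_gt1 // /hits /= /core_value big_cons.
case: (4 %| _)%N; rewrite /= ?mulr0 //.
by case: (p %| _)%N; rewrite /= ?mul0r //; case: ifP; rewrite ?mulr0 // mulrCA.
Qed.

Lemma core_value_ge0 C : 0 <= core_value C.
Proof. by rewrite mulr_ge0 ?ler0n // prodr_ge0 // => p _; rewrite divr_ge0 ?ler0n. Qed.

Lemma sieve_cost_bound C p alpha r :
    all (odd_prime_divisor q) (p :: C) -> uniq (p :: C) -> alpha != 0 -> (q <= r ^ 2)%N ->
  `|\sum_x trig_eval (trig_mul (multiple_trig p) (core_trig C)) (alpha * (theta + emb x))|
  <= (p.-1 * sieve_cost q (core_size C) (core_triv q C) r p)%:R.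
Proof.
case/andP=> /and3P[pp op pn] aC /andP[pC uC] a0 qr.
have [sC aCn nCn nC1 nCq] := core_trig_sums aC uC.
have p0 := prime_gt0 pp.
have sp := trig_geom_supp pn (fun j => (j != 0%N)%:R).
have cop : coprime p (4 * \prod_(p <- C) p).
  by apply: coprime_prod => //; apply: sub_all aC => c /and3P[].
have s1 : trig_sum Num.norm 1 (multiple_trig p) = p.-1%:R.
  rewrite trig_geom_sum1; case: p {pp op pn aC pC uC p0 sp cop} => [|p]; first by rewrite big_ord0.
  rewrite big_ord_recl /= normr0 add0r (eq_bigr (fun _ => 1)) ?sumr_const ?card_ord //.
  by move=> j _; rewrite normr1.
have := line_trig_bound (trig_mul (multiple_trig p) (core_trig C)) a0 qr.
rewrite !(trig_sum_mul (@normrM _) _ cop) ?dvdn_order ?dvd1n //.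
rewrite (trig_sum_mul _ _ cop) // s1 !trig_geom_sumn // eqxx normr0 !mul0r mulr0 !subr0.
rewrite nC1 nCq trig_geom_sumq_prime // s1 trig_geom_sumn // eqxx normr0.
move/le_trans; apply; have /andP[_ UT] := core_triv_le q C.
rewrite /sieve_cost; case: ifP => _; last first.
  by rewrite mul0r add0r subr0 -!natrM mulnA.
rewrite -!natrM -natrB; last by rewrite leq_mul2l UT orbT.
by rewrite -natrM -natrD ler_nat mulnDr addnC mulnA mulnBr.
Qed.

(** If nothing hits, every point where the core polynomial is positive has a logarithm divisible by
    some [p] in [S]. Hence its total [N] over the line is at most the sum over [p] of
    [(N + E p) / p], where [E p <= p.-1 * sieve_cost]. With denominators cleared, this contradicts
    the lower bound on [N]. *)
Theorem line_sieve C S alpha r :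
    all (odd_prime_divisor q) (C ++ S) -> uniq (C ++ S) -> alpha != 0 -> (q <= r ^ 2)%N ->
    (let T := core_size C in let U := core_triv q C in
     sieve_err q T U r S <
     (\prod_(p <- S) p - sieve_den S) * (q - ((T - U) * r + U.-1)))%N ->
  exists x, hits (C ++ S) (dlog (alpha * (theta + emb x))).
Proof.
rewrite all_cat cat_uniq => /andP[aC aS] /and3P[uC dCS uS] a0 qr /= ineq.
apply/existsP; apply: contraLR ineq; rewrite negb_exists -leqNgt => /forallP nohit.
have [sC aCn nCn nC1 nCq] := core_trig_sums aC uC.
have /andP[U0 UT] := core_triv_le q C.
set T := core_size C in nC1 UT *; set U := core_triv q C in nCq U0 UT *.
pose z x := alpha * (theta + emb x).
have z0 x : z x != 0 by rewrite mulf_neq0 ?line_neq0.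
pose f x := trig_eval (core_trig C) (z x).
have fE x : f x = if hits C (dlog (z x)) then core_value C else 0.
  exact: core_trig_eval.
have f0 x : 0 <= f x by rewrite fE; case: ifP => // _; exact: core_value_ge0.
pose N := \sum_x f x.
have N0 : 0 <= N by rewrite sumr_ge0.
(* The main term uses up the trivial character, whence [U.-1]. If the error exceeds [q], the
   truncated difference is 0 and the bound is trivial. *)
have Nlow : (q - ((T - U) * r + U.-1))%N%:R <= N.
  have := line_trig_bound (core_trig C) a0 qr.
  rewrite aCn nCn nC1 nCq mulr1 -/N => bnd.
  have : q%:R - N <= ((T - U) * r + U.-1)%:R.
    rewrite (le_trans (real_ler_norm _)) ?realB ?realn ?ger0_real // distrC.
    apply: le_trans bnd _.
    rewrite -{1}(prednK U0) -natr1 addrK -natrB // -natrM -natrD ler_nat addnC.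
    exact: leqnn.
  have [le_q|lt_q] := leqP q ((T - U) * r + U.-1).
    by rewrite (eqP le_q).
  by rewrite natrB 1?ltnW // !lerBlDr [N + _]addrC.
pose E p := \sum_x trig_eval (trig_mul (multiple_trig p) (core_trig C)) (z x).
have EE p : odd_prime_divisor q p ->
    E p + N = p%:R * \sum_x f x * (p %| dlog (z x))%N%:R.
  case/and3P=> pp _ pn; rewrite /E /N -big_split mulr_sumr /=; apply: eq_bigr => x _.
  rewrite trig_eval_mul multiple_trig_eval ?prime_gt0 // mulrBl mul1r subrK -/(f x).
  by case: (p %| _)%N; rewrite ?mulr1 ?mulr0 ?mul0r.
have Ebnd p : p \in S -> E p <= (p.-1 * sieve_cost q T U r p)%:R.
  (* Comparing [E p] with its norm requires it to be real: it is a difference of two nonnegative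
     sums. *)
  move=> pS; have /allP/(_ p pS) pd := aS; rewrite (le_trans (real_ler_norm _)) //.
    have -> : E p = (E p + N) - N by rewrite addrK.
    rewrite realB ?ger0_real // EE // mulr_ge0 ?ler0n // sumr_ge0 // => x _.
    by rewrite mulr_ge0 ?ler0n.
  apply: sieve_cost_bound => //; first by rewrite /= pd.
  by rewrite /= uC andbT; apply: contra dCS => pC; apply/hasP; exists p.
have key : N <= \sum_(p <- S) \sum_x f x * (p %| dlog (z x))%N%:R.
  rewrite exchange_big /=; apply: ler_sum => x _; rewrite -mulr_sumr.
  have := nohit x; rewrite -/(z x) /hits all_cat fE /hits.
  case: (4 %| _)%N => /=; last by rewrite mul0r.
  case: (all _ C) => /=; last by rewrite mul0r.
  case/allPn=> p pS; rewrite negbK => pd; rewrite ler_peMr ?core_value_ge0 //.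
  rewrite (big_rem p) //= pd lerDl sumr_ge0 // => i _; exact: ler0n.
have sumS (S' : seq nat) : {subset S' <= S} ->
    (\prod_(p <- S') p)%:R * \sum_(p <- S') \sum_x f x * (p %| dlog (z x))%N%:R
    <= (sieve_den S')%:R * N + (sieve_err q T U r S')%:R.
  elim: S' => [|p S' IH] sub; first by rewrite !big_nil /= mulr0 mul0r addr0.
  have pS : p \in S by apply: sub; rewrite inE eqxx.
  have {}IH := IH (fun s sin => sub s (@mem_behead _ (p :: S') s sin)).
  rewrite !big_cons /= natrM mulrDr.
  have /allP/(_ p pS) pd := aS.
  rewrite mulrAC -(EE p pd).
  have le1 : (E p + N) * (\prod_(p <- S') p)%:R
     <= ((p.-1 * sieve_cost q T U r p)%:R + N) * (\prod_(p <- S') p)%:R.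
    by rewrite ler_wpM2r ?ler0n // lerD2r Ebnd.
  have le2 := ler_wpM2l (ler0n _ p) IH.
  rewrite -mulrA; apply: le_trans (lerD le1 le2) _; rewrite le_eqVlt; apply/orP; left; apply/eqP.
  by rewrite !natrD !natrM; ring.
have := sumS S (fun _ => id).
have /ler_wpM2l := key; move/(_ (\prod_(p <- S) p)%:R (ler0n _ _)) => key2.
move/(le_trans key2) => key3.
have [le_den|lt_den] := leqP (\prod_(p <- S) p) (sieve_den S).
  by rewrite (eqP le_den) mul0n.
rewrite -(ler_nat algC) natrM; apply: le_trans (ler_wpM2l (ler0n _ _) Nlow) _.
by rewrite natrB 1?ltnW // mulrBl lerBlDl.
Qed.

End Sieve.

End QuadraticExtension.

(** * From admissible logarithms to 2-primitive elements *)

Definition two_primitive_lines (q : nat) : Prop :=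
  forall (F K : finFieldType) (emb : {rmorphism F -> K}),
    #|F| = q -> #|K| = (q ^ 2)%N ->
  forall alpha theta : K, alpha != 0 -> (forall x, theta != emb x) ->
  exists x, ((q ^ 2 - 1) %/ 2)%N.-primitive_root (alpha * (theta + emb x)).

Local Open Scope nat_scope.

Lemma dvd8_order q : odd q -> 8 %| q ^ 2 - 1.
Proof.
move=> oq; have := odd_double_half q; rewrite oq; set m := q./2 => qE.
have -> : q ^ 2 - 1 = 4 * (m * m.+1) by rewrite -qE; lia.
by rewrite (_ : 8 = 4 * 2) // dvdn_mul // dvdn2 oddM /= andbN.
Qed.

(** Write the gcd as [2 * e]. A prime factor of [e] is either odd, hence in [C] and excluded, or 2,
    and then 4 would divide [s]. *)
Lemma hits_gcdn q C s : odd q ->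
  (forall p, odd_prime_divisor q p -> p \in C) -> hits C s -> gcdn s (q ^ 2 - 1) = 2.
Proof.
move=> oq inC /andP[s4 /allP sC]; have n8 := dvd8_order oq.
have n2 : 2 %| q ^ 2 - 1 by apply: dvdn_trans n8.
have s2 : 2 %| s.
  by rewrite -(dvdn_addl s (dvdnn 2)); apply: dvdn_trans s4.
have d2 : 2 %| gcdn s (q ^ 2 - 1) by rewrite dvdn_gcd s2.
have /dvdnP[e eE] := d2; rewrite eE.
have e0 : 0 < e.
  have: 0 < gcdn s (q ^ 2 - 1).
    rewrite gcdn_gt0 orbC subn_gt0 -{1}(exp1n 2) ltn_exp2r //.
    case: s s4 {s2 d2 eE sC} => //; rewrite ?add0n => s _; exact: orbT.
  by rewrite eE muln_gt0 => /andP[].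
have [->//|e1] := eqVneq e 1.
have pp : prime (pdiv e) by apply: pdiv_prime; rewrite ltn_neqAle eq_sym e1.
have pe := pdiv_dvd e; set p := pdiv e in pp pe.
have pg : p %| gcdn s (q ^ 2 - 1) by rewrite eE dvdn_mulr.
move: pg; rewrite dvdn_gcd => /andP[ps pn].
case: (boolP (odd p)) => op.
  have /sC := inC p (introT and3P (And3 pp op pn)).
  by rewrite ps.
have p2 : p = 2 by case: (even_prime pp) => // p2; rewrite p2 in op.
have : 4 %| gcdn s (q ^ 2 - 1).
  by rewrite eE (_ : 4 = 2 * 2) // dvdn_mul // -p2.
rewrite dvdn_gcd => /andP[s4' _].
by move: s4; rewrite dvdn_addr.
Qed.

Definition sieve_ineq (q r : nat) (C S : seq nat) : bool :=
  let T := core_size C in let U := core_triv q C in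
  sieve_err q T U r S <
  (\prod_(p <- S) p - sieve_den S) * (q - ((T - U) * r + U.-1)).

Lemma sieve_lines q r C S : odd q ->
    all (odd_prime_divisor q) (C ++ S) -> uniq (C ++ S) ->
    (forall p, odd_prime_divisor q p -> p \in C ++ S) ->
    q <= r ^ 2 -> sieve_ineq q r C S ->
  two_primitive_lines q.
Proof.
move=> oq aCS uCS inCS qr ineq F K emb cF cK alpha theta a0 th.
subst q.
have [zeta pz] := C_prim_root_exists (order_gt0 F).
have [g pg] := finField_prim_root K; rewrite cK -subn1 in pg.
have [x hx] := line_sieve cK pg th pz oq aCS uCS a0 qr ineq.
exists x; rewrite -{2}(hits_gcdn oq inCS hx).
have z0 : (alpha * (theta + emb x) != 0)%R by rewrite mulf_neq0 ?line_neq0.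
by rewrite -{2}(dlogK cK pg z0) exp_prim_root.
Qed.

(** * Large q *)

Definition odd_primes (q : nat) := [seq p <- primes (q ^ 2 - 1) | odd p].

Lemma mem_odd_primes q p : 1 < q -> (p \in odd_primes q) = odd_prime_divisor q p.
Proof.
move=> q1; rewrite mem_filter mem_primes /odd_prime_divisor subn_gt0.
by rewrite -{1}(exp1n 2) ltn_exp2r // q1 andbCA.
Qed.

Lemma sorted_odd_primes q : sorted ltn (odd_primes q).
Proof. by apply: sorted_filter (sorted_primes _); apply: ltn_trans. Qed.

Lemma prod_primes_dvd m (s : seq nat) :
  uniq s -> all prime s -> all (dvdn^~ m) s -> \prod_(p <- s) p %| m.
Proof.
elim: s => [|p s IH] /=; first by rewrite big_nil dvd1n.
case/andP=> ps us /andP[pp ap] /andP[pm am]; rewrite big_cons Gauss_dvd ?pm ?IH //.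
elim: s ps ap {IH us am} => [|c C IH] /=; first by rewrite big_nil coprimen1.
rewrite inE negb_or => /andP[pc pC] /andP[cp aC].
by rewrite big_cons coprimeMr prime_coprime // dvdn_prime2 // pc IH.
Qed.

Lemma prod_odd_primes_lt q : odd q -> 1 < q ->
  8 * \prod_(p <- odd_primes q) p < q ^ 2.
Proof.
move=> oq q1; have n0 : 0 < q ^ 2 - 1.
  by rewrite subn_gt0 -{1}(exp1n 2) ltn_exp2r.
have: 8 * \prod_(p <- odd_primes q) p %| q ^ 2 - 1.
  rewrite Gauss_dvd ?dvd8_order //=; last first.
    rewrite (_ : 8 = 2 ^ 3) // coprimeXl // coprime2n.
    rewrite big_filter; elim/big_ind: _ => //= a b oa ob; by rewrite oddM oa.
  apply: prod_primes_dvd; first exact: filter_uniq (primes_uniq _).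
    by apply/allP=> p; rewrite mem_odd_primes // => /and3P[].
  by apply/allP=> p; rewrite mem_odd_primes // => /and3P[].
by move/(dvdn_leq n0) => le_n; rewrite -(subnK (ltnW (_ : 1 < q ^ 2))) ?addn1 ?ltnS // -subn_gt0.
Qed.

Definition first_odd_primes : seq nat :=
  [:: 3; 5; 7; 11; 13; 17; 19; 23; 29; 31; 37; 41; 43; 47; 53; 59; 61; 67].

(** By induction: the prime divisors increase strictly, and no prime lies between consecutive
    entries of the table. Past its end the default value 67 is still a lower bound. *)
Lemma nth_odd_primes q i : i < size (odd_primes q) ->
  nth 67 first_odd_primes i <= nth 0 (odd_primes q) i.
Proof.
have prs j : j < size (odd_primes q) ->
    prime (nth 0 (odd_primes q) j) /\ odd (nth 0 (odd_primes q) j).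
  move=> /(mem_nth 0); set x := nth _ _ _; rewrite mem_filter => /andP[ox].
  by rewrite mem_primes => /and3P[].
elim: i => [|i IH] lti.
  have [pp op] := prs _ lti; move: (nth 0 _ 0) pp op => [|[|[|x]]] //.
have [pp op] := prs _ lti; have := IH (ltnW lti).
have: nth 0 (odd_primes q) i < nth 0 (odd_primes q) i.+1.
  by apply: (sorted_ltn_nth ltn_trans 0 (sorted_odd_primes q)); rewrite ?inE // ltnW.
move: (nth 0 _ i) (nth 0 _ i.+1) pp op => a b pb ob ab ia.
have {}ab := leq_ltn_trans ia ab.
have gaps : all (fun i => let o := nth 67 first_odd_primes in
    all (fun m => ~~ prime m) (iota (o i).+1 (o i.+1 - (o i).+1))) (iota 0 17) by [].
have [i17|i17] := ltnP i 17; last first.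
  rewrite nth_default // ltnW //; move: ab.
  by rewrite -(subnKC i17); case: (i - 17) => // j; rewrite nth_default.
rewrite leqNgt; apply/negP => ba.
have /allP/(_ i) := gaps; rewrite mem_iota i17 => /(_ isT)/allP/(_ b).
by rewrite mem_iota ab subnKC ?pb ?(ltnW (leq_ltn_trans ab ba)) // => /(_ ba).
Qed.

Fixpoint dominates (s o : seq nat) : bool :=
  match s, o with
  | [::], _ => true
  | _ :: _, [::] => false
  | p :: s', x :: o' => (x <= p) && dominates s' o'
  end.

Lemma dominatesP s o : size s <= size o ->
  (forall i, i < size s -> nth 67 o i <= nth 0 s i) -> dominates s o.
Proof.
elim: s o => [|p s IH] [|x o] //= so dom; rewrite (dom 0) //=.
by apply: IH => // i lti; apply: (dom i.+1).
Qed.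

Lemma dominates_drop c s o : dominates s o -> dominates (drop c s) (drop c o).
Proof.
by elim: c s o => [|c IH] s o; rewrite ?drop0 //; case: s o => [|p s] [|x o] //= /andP[_ /IH].
Qed.

(** A comparison of sums of reciprocals, with denominators cleared. *)
Lemma dominates_den s o : dominates s o ->
  sieve_den s * \prod_(p <- o) p <= sieve_den o * \prod_(p <- s) p.
Proof.
elim: s o => [|p s IH] [|x o] //= /andP[xp /IH le]; rewrite !big_cons.
move: le; set P := \prod_(_ <- s) _; set O := \prod_(_ <- o) _.
move: (sieve_den s) (sieve_den o) => a b le.
have h1 : p * x * (a * O) <= p * x * (b * P) by rewrite leq_mul2l le orbT.
have h2 : x * (P * O) <= p * (P * O) by rewrite leq_mul2r xp orbT.
by move: h1 h2; rewrite -!mulnA; lia.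
Qed.

(** Each cost is at most [T * r], so relative to the product the error is at most [T * r] times the
    sum of [1 - 1 / p]. *)
Lemma sieve_err_le q T U r S : U <= T -> 0 < r -> all (leq 1) S ->
  sieve_err q T U r S + T * r * sieve_den S <= T * r * (size S * \prod_(p <- S) p).
Proof.
move=> UT r0; elim: S => [|p S IH] //= /andP[p0 /IH]; rewrite big_cons.
have : sieve_cost q T U r p <= T * r.
  rewrite /sieve_cost; case: ifP => // _.
  by rewrite mulnBl -{2}(subnK (leq_mul UT (leqnn r))) leq_add2l leq_pmulr.
move: (sieve_cost _ _ _ _ _) (sieve_err _ _ _ _ _) (sieve_den S) => k e d kT le.
set P := \prod_(_ <- _) _ in le *.
have h1 : p.-1 * P * k <= p.-1 * P * (T * r) by rewrite leq_mul2l kT orbT.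
have h2 := leq_mul (leqnn p) le.
have h3 : T * r * P * p.-1.+1 = T * r * P * p by rewrite prednK.
by move: h1 h2 h3; lia.
Qed.

Lemma core_triv_ge2 q C : 2 <= core_triv q C.
Proof.
rewrite /core_triv -{1}[2]muln1 leq_mul ?expn_gt0 //; by case: ifP.
Qed.

Lemma ceil_sqrt q : 0 < q -> exists2 r, q <= r ^ 2 & (r.-1) ^ 2 < q.
Proof.
move=> q0; have ex : exists r, q <= r ^ 2.
  by exists q; rewrite -{1}(expn1 q) leq_pexp2l.
case: (ex_minnP ex) => r qr rmin; exists r => //; rewrite ltnNge; apply/negP => /rmin.
by case: r qr {rmin} => [|r] //=; [rewrite leqNgt q0 | rewrite ltnn].
Qed.

(** Let [r] be the rounded up square root of [q], [P] the product of [S] and [A = P - sieve_den S].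
    The error is at most [T * r * (W * P + A)] and the main factor exceeds [r * (r - T)], so
    [T * W * P <= A * (r - 2 * T)] suffices. The numerical hypothesis is this inequality for [o],
    [4 * 2 ^ K] and [R.+1]; passing to [S], [T] and [r] only improves it. *)
Lemma large_sieve_lines q C S K W : odd q -> 1 < q ->
    odd_primes q = C ++ S -> size C <= K ->
    forall o, dominates S o -> 0 < \prod_(p <- o) p -> 
    sieve_den o < \prod_(p <- o) p -> size S <= W.+1 ->
    forall R, R ^ 2 < q ->
    4 * 2 ^ K * W * \prod_(p <- o) p
      <= (\prod_(p <- o) p - sieve_den o) * (R.+1 - 2 * (4 * 2 ^ K)) ->
    2 * (4 * 2 ^ K) <= R ->
  two_primitive_lines q.
Proof.
move=> oq q1 oE CK o dom O0 denO SW R Rq num TR.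
have [r qr rq] := ceil_sqrt (ltnW q1).
have Rr : R < r by rewrite -(ltn_exp2r _ _ (isT : 0 < 2)) (leq_trans Rq).
have r0 : 0 < r by apply: leq_ltn_trans Rr.
have inCS p : odd_prime_divisor q p -> p \in C ++ S by rewrite -oE mem_odd_primes.
have aCS : all (odd_prime_divisor q) (C ++ S).
  by apply/allP=> p; rewrite -oE mem_odd_primes.
apply: (sieve_lines oq aCS _ inCS qr).
  by rewrite -oE filter_uniq ?primes_uniq.
have aS : all (leq 1) S.
  apply/allP=> p pS; have /allP/(_ p) := aCS.
  by rewrite mem_cat pS orbT => /(_ isT)/and3P[/prime_gt0].
have P0 : 0 < \prod_(p <- S) p.
  by rewrite big_seq prodn_cond_gt0 // => i /(allP aS).
rewrite /sieve_ineq.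
have /andP[_ UT] := core_triv_le q C; have U2 := core_triv_ge2 q C.
have TT : core_size C <= 4 * 2 ^ K by rewrite leq_mul2l leq_exp2l.
have errle := sieve_err_le q UT r0 aS.
have denle := dominates_den dom.
move: (sieve_err _ _ _ _ _) errle => e; move: (core_size C) UT TT => T UT TT.
move: (core_triv q C) U2 UT => U U2 UT.
move: (4 * 2 ^ K) TT num TR => T0 TT num TR.
move: (\prod_(p <- S) p) P0 (sieve_den S) denle => P P0 d denle.
move: (\prod_(p <- o) p) O0 denO num denle => O O0 denO num denle.
move: (sieve_den o) denO num denle => b denO num denle errle.
have dP : d < P.
  rewrite -(ltn_pmul2r O0); apply: leq_ltn_trans denle _.
  by rewrite [P * O]mulnC ltn_pmul2r.
pose A := P - d; pose A0 := O - b.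
have AA : A0 * P <= A * O.
  by rewrite /A /A0 !mulnBl [P * O]mulnC leq_sub2l.
have A1 : 0 < A by rewrite subn_gt0.
have h1 : T * W * P <= A * (r - 2 * T).
  rewrite -(leq_pmul2r O0).
  have s1 : T * W * P * O <= T0 * W * O * P.
    by rewrite -mulnA [P * O]mulnC mulnA leq_mul2r leq_mul2r leq_mul2r TT !orbT.
  apply: leq_trans s1 _.
  have s2 : T0 * W * O * P <= A0 * (r - 2 * T) * P.
    rewrite leq_mul2r; apply/orP; right; apply: leq_trans num _.
    by rewrite leq_mul2l; apply/orP; right; apply: leq_sub => //; rewrite leq_mul2l TT orbT.
  apply: leq_trans s2 _.
  by rewrite mulnAC [A * _ * O]mulnAC leq_mul2r AA orbT.
(* By [(r - 1) ^ 2 < q] and [2 <= U], the right side is larger by at least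
   [(U - 2) * (r - 1) + 1]. *)
have qlow : r * (r - T) < q - ((T - U) * r + U.-1).
  have Tr : T < r.
    by apply: leq_ltn_trans TT (leq_ltn_trans (leq_trans _ TR) Rr); rewrite leq_pmull.
  have [t rE] : exists t, r = T + t.+1.
    by exists (r - T).-1; rewrite prednK ?subn_gt0 // subnKC // ltnW.
  have [u UE] : exists u, U = u.+2 by exists (U - 2); rewrite -addn2 subnK.
  have [v TE] : exists v, T = U + v by exists (T - U); rewrite subnKC.
  have h : q >= r.-1 * r.-1 + 1 by rewrite addn1 mulnn.
  subst r; rewrite addKn.
  rewrite (_ : T - U = v); last by rewrite TE addKn.
  move: h; rewrite addnS /= UE /= => h; rewrite ltn_subRL.
  apply: leq_trans h; rewrite ltnS addn0; subst T U.
  set X := u.+2 + v + t; rewrite (_ : u.+2 + v + t.+1 = X.+1) 1?addnS //=.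
  have -> : X * X = v * X.+1 + u.+1 + X.+1 * t.+1 + u * X by rewrite /X; lia.
  by rewrite mulSn; lia.
have eb : e + T * r * d <= T * r * (W.+1 * P).
  by apply: leq_trans errle _; rewrite leq_mul2l leq_mul2r SW !orbT.
have h3 : e <= T * r * (W * P + A).
  rewrite -(leq_add2r (T * r * d)); apply: leq_trans eb _.
  by rewrite -mulnDr -addnA /A subnK ?(ltnW dP) // mulSn [P + _]addnC.
apply: leq_ltn_trans h3 _.
apply: leq_ltn_trans (_ : A * (r * (r - T)) < _); last by rewrite ltn_pmul2l.
have Tr2 : 2 * T <= r.
  by apply: leq_trans (ltnW Rr); apply: leq_trans TR; rewrite leq_mul2l TT orbT.
have [t rE] : exists t, r = 2 * T + t by exists (r - 2 * T); rewrite subnKC.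
have -> : r - T = T + (r - 2 * T) by rewrite rE; lia.
rewrite (_ : T * r * (W * P + A) = r * (A * T + T * W * P)); last by ring.
by rewrite [A * (r * _)]mulnCA leq_mul2l mulnDr leq_add2l h1 orbT.
Qed.

Lemma leq_prod_nth d (o s : seq nat) : size o <= size s -> all (leq 1) s ->
  (forall i, i < size o -> nth d o i <= nth 0 s i) ->
  \prod_(p <- o) p <= \prod_(p <- s) p.
Proof.
elim: o s => [|x o IH] [|p s] //=.
- move=> _ /andP[p0 as1] _; rewrite big_nil big_cons muln_gt0 p0 big_seq prodn_cond_gt0 //.
  by move=> i /(allP as1).
move=> so /andP[p0 as1] dom; rewrite !big_cons leq_mul ?(dom 0) // IH // => i lti.
exact: (dom i.+1).
Qed.

Lemma odd_primes_ge1 q : all (leq 1) (odd_primes q).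
Proof. by apply/allP=> p; rewrite mem_filter mem_primes => /andP[_ /and3P[/prime_gt0]]. Qed.

(** With more than [W] odd prime divisors, 8 times the product of the first [W.+1] odd primes would
    be less than [q ^ 2]. *)
Lemma size_odd_primes_le q W B : odd q -> 1 < q -> q <= B -> W < 18 ->
  B ^ 2 <= 8 * \prod_(p <- take W.+1 first_odd_primes) p -> size (odd_primes q) <= W.
Proof.
move=> oq q1 qB W18 num; rewrite leqNgt; apply/negP => Ws.
have := prod_odd_primes_lt oq q1; rewrite ltnNge => /negP; apply.
have qB2 : q ^ 2 <= B ^ 2 by rewrite leq_exp2r.
have sz : size (take W.+1 first_odd_primes) = W.+1 by rewrite size_takel.
have nthE i : i < W.+1 -> nth 67 (take W.+1 first_odd_primes) i = nth 67 first_odd_primes i.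
  by move=> lti; rewrite nth_take.
move: (take _ _) sz nthE num => o sz nthE num.
apply: leq_trans qB2 (leq_trans num _); rewrite leq_mul2l /=.
apply: (@leq_prod_nth 67); rewrite ?sz ?odd_primes_ge1 // => i lti.
by rewrite nthE // nth_odd_primes // (leq_trans lti).
Qed.

(** The core takes the [c] smallest odd prime divisors; the others are compared with the odd primes
    of rank [c + 1] to [W]. *)
Lemma sieve_lines_size q c W R : odd q -> 1 < q -> size (odd_primes q) <= W -> c < W <= 18 ->
    let o := drop c (take W first_odd_primes) in
    let T := 4 * 2 ^ c in
    0 < \prod_(p <- o) p -> sieve_den o < \prod_(p <- o) p ->
    T * (W - c).-1 * \prod_(p <- o) p
      <= (\prod_(p <- o) p - sieve_den o) * (R.+1 - 2 * T) ->
    2 * T <= R -> R ^ 2 < q ->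
  two_primitive_lines q.
Proof.
move=> oq q1 sW /andP[cW W18] o T O0 denO num TR Rq.
apply: (@large_sieve_lines q (take c (odd_primes q)) (drop c (odd_primes q))
  c (W - c).-1 oq q1 _ _ o _ O0 denO _ R Rq num TR).
- by rewrite cat_take_drop.
- by rewrite size_take; case: ltnP => // /ltnW.
- apply/dominates_drop/dominatesP; first by rewrite size_takel.
  by move=> i lti; rewrite nth_take ?nth_odd_primes // (leq_trans lti).
by rewrite size_drop prednK ?subn_gt0 // leq_sub2r.
Qed.

(** All primes go into the core, so no union bound remains, and [q > (8 * 2 ^ k) ^ 2] suffices for
    [k] primes. *)
Lemma many_primes_lines q : odd q -> 1 < q -> 18 <= size (odd_primes q) ->
  two_primitive_lines q.
Proof.
move=> oq q1 s18; set s := odd_primes q in s18 *.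
(* The constants satisfy [8 * 512 * 16 ^ k = (8 * 2 ^ k) ^ 4], which is to be compared with
   [q ^ 2]. *)
have big : 512 * 16 ^ size s <= \prod_(p <- s) p.
  pose o := first_odd_primes ++ nseq (size s - 18) 67.
  have so : size o = size s by rewrite size_cat size_nseq subnKC.
  apply: (@leq_trans (\prod_(p <- o) p)).
    rewrite -{1}(subnKC s18) expnD mulnA big_cat leq_mul //=.
      by rewrite !big_cons big_nil; lia.
    by elim: (size s - 18) => [|k IH]; rewrite ?big_nil //= big_cons expnS leq_mul.
  apply: (@leq_prod_nth 67); rewrite ?so ?odd_primes_ge1 // => i lti.
  apply: leq_trans (nth_odd_primes lti); rewrite nth_cat.
  by case: ltnP => // hi; rewrite nth_nseq if_same nth_default.
have qbig : (2 * (4 * 2 ^ size s)) ^ 2 < q.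
  have := prod_odd_primes_lt oq q1; rewrite -/s => lt.
  rewrite -(ltn_exp2r _ _ (isT : 0 < 2)); apply: leq_ltn_trans lt.
  apply: leq_trans (_ : 8 * (512 * 16 ^ size s) <= _); last by rewrite leq_mul2l.
  have -> : 16 ^ size s = (2 ^ size s) ^ 4 by rewrite -expnM mulnC expnM.
  by move: (2 ^ size s) => x; apply: eq_leq; ring.
apply: (@large_sieve_lines q s [::] (size s) 0 oq q1 _ _ [::] _ _ _ _ _ qbig) => //=.
- by rewrite cats0.
- by rewrite big_nil.
- by rewrite big_nil.
by rewrite muln0.
Qed.

(** A bootstrap: an upper bound on [q] limits the number of prime divisors, and this lowers the
    threshold above which the sieve succeeds. The thresholds for at most 17, 9, 8 and 7 primes are
    the squares of 733, 202, 159 and 121. *)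
Lemma large_q_lines q : odd q -> 121 ^ 2 < q -> two_primitive_lines q.
Proof.
move=> oq q_large; have q1 : 1 < q by apply: leq_ltn_trans q_large; rewrite expn_gt0.
have [|s18] := leqP 18 (size (odd_primes q)); first exact: many_primes_lines.
have [q_le|] := leqP q (733 ^ 2); last first.
  apply: (@sieve_lines_size q 2 17 733) => //=; rewrite !big_cons big_nil; lia.
have s9 : size (odd_primes q) <= 9.
  apply: (size_odd_primes_le oq q1 q_le) => //=; rewrite !big_cons big_nil; lia.
have [{}q_le|] := leqP q (202 ^ 2); last first.
  apply: (@sieve_lines_size q 1 9 202) => //=; rewrite !big_cons big_nil; lia.
have s8 : size (odd_primes q) <= 8.
  apply: (size_odd_primes_le oq q1 q_le) => //=; rewrite !big_cons big_nil; lia.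
have [{}q_le|] := leqP q (159 ^ 2); last first.
  apply: (@sieve_lines_size q 1 8 159) => //=; rewrite !big_cons big_nil; lia.
have s7 : size (odd_primes q) <= 7.
  apply: (size_odd_primes_le oq q1 q_le) => //=; rewrite !big_cons big_nil; lia.
apply: (@sieve_lines_size q 1 7 121) => //=; rewrite ?big_cons ?big_nil; lia.
Qed.

(** * Evaluation of the sieve inequality *)

Local Notation "[Nat n ]" := (N.to_nat n) (format "[Nat  n ]").

(* The fuel is enough as soon as [n < (d + 2 * fuel) ^ 2]. *)
Fixpoint trial_division (fuel : nat) (d n : N) : seq N :=
  let stop := if (1 <? n)%num then [:: n] else [::] in
  if fuel is f.+1 then
    if (n <? d * d)%num then stop
    else if (n mod d =? 0)%num then
      let n' := (n / d)%num in
      if (n' mod d =? 0)%num then trial_division f d n'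
      else d :: trial_division f (d + 2) n'
    else trial_division f (d + 2) n
  else stop.

Lemma to_nat_divmod (d n : N) : (0 < d)%num ->
  [Nat (n mod d)] = [Nat n] %% [Nat d] /\ [Nat (n / d)] = [Nat n] %/ [Nat d].
Proof.
move=> d0; have lt : [Nat (n mod d)] < [Nat d] by have := N.mod_lt n d; lia.
have nE : [Nat n] = [Nat (n / d)] * [Nat d] + [Nat (n mod d)].
  by rewrite {1}(N.div_mod n d); lia.
by rewrite nE modnMDl modn_small // divnMDl ?divn_small ?addn0 //; lia.
Qed.

Lemma to_nat_dvd (d n : N) : (0 < d)%num -> (n mod d =? 0)%num = ([Nat d] %| [Nat n]).
Proof.
move=> d0; have [nE _] := to_nat_divmod n d0; rewrite /dvdn -nE.
by apply/idP/idP => [/N.eqb_eq -> | /eqP h] //; apply/N.eqb_eq; lia.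
Qed.

(** A candidate [d] dividing [n] is prime, since its least prime factor cannot be below [d]. It is
    emitted only once it no longer divides the quotient, so no prime is repeated. *)
Lemma trial_divisionP fuel d n : (3 <= d)%num -> odd [Nat d] -> 0 < [Nat n] -> odd [Nat n] ->
    (forall p, prime p -> p %| [Nat n] -> [Nat d] <= p) ->
    [Nat n] < ([Nat d] + 2 * fuel) ^ 2 ->
    let l := map N.to_nat (trial_division fuel d n) in
  uniq l /\ (forall p, (p \in l) = prime p && (p %| [Nat n])).
Proof.
have stopP d' n' : [Nat n'] < [Nat d'] ^ 2 -> 0 < [Nat n'] ->
    (forall p, prime p -> p %| [Nat n'] -> [Nat d'] <= p) ->
    let l := map N.to_nat (if (1 <? n')%num then [:: n'] else [::]) in
    uniq l /\ (forall p, (p \in l) = prime p && (p %| [Nat n'])).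
  move=> nd n0 big; case: N.ltb_spec => n1 /=; split=> // p; last first.
    have -> : [Nat n'] = 1 by lia.
    by rewrite in_nil dvdn1; case: eqP => [->|]; rewrite ?andbF.
  have pn : prime [Nat n'].
    have n1' : 1 < [Nat n'] by lia.
    case: (boolP (prime _)) => // np.
    have := big _ (pdiv_prime n1') (pdiv_dvd _).
    rewrite leqNgt => /negP[]; rewrite -(ltn_exp2r _ _ (isT : 0 < 2)).
    by apply: leq_ltn_trans nd; rewrite leqNgt; apply: contra np; apply: ltn_pdiv2_prime n0.
  rewrite inE; apply/eqP/andP => [->|[pp]]; first by rewrite pn.
  by rewrite dvdn_prime2 // => /eqP.
elim: fuel d n => [|f IH] d n d3 od n0 on big lt.
  by apply: (stopP d) => //; move: lt; rewrite muln0 addn0.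
rewrite /trial_division -/trial_division; cbv zeta.
case: N.ltb_spec => ndd; first by apply: (stopP d) => //; rewrite -mulnn; lia.
have d0 : (0 < d)%num by lia.
have odS : odd [Nat (d + 2)] by rewrite (_ : [Nat (d + 2)] = [Nat d].+2) /= ?negbK //; lia.
have bigS n' : [Nat n'] %| [Nat n] -> ~~ ([Nat d] %| [Nat n']) ->
    forall p, prime p -> p %| [Nat n'] -> [Nat (d + 2)] <= p.
  move=> n'n dn' p pp pn'; have dp := big p pp (dvdn_trans pn' n'n).
  have op : odd p by apply: dvdn_odd on; apply: dvdn_trans pn' n'n.
  have : [Nat d] != p by apply: contra dn' => /eqP->.
  by move: od op; lia.
rewrite to_nat_dvd //; case: ifP => dn; last first.
  apply: IH => //; first lia; first by apply: bigS; rewrite ?dvdnn ?dn.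
  by rewrite (_ : [Nat (d + 2)] + 2 * f = [Nat d] + 2 * f.+1) //; lia.
have nE : [Nat n] = [Nat (n / d)] * [Nat d].
  by have [_ ->] := to_nat_divmod n d0; rewrite divnK.
have n'n : [Nat (n / d)] %| [Nat n] by rewrite nE dvdn_mulr.
have n'0 : 0 < [Nat (n / d)] by move: n0; rewrite nE muln_gt0 => /andP[].
have on' : odd [Nat (n / d)] by apply: dvdn_odd on.
have pd : prime [Nat d].
  have d1 : 1 < [Nat d] by lia.
  have := big _ (pdiv_prime d1) (dvdn_trans (pdiv_dvd _) dn).
  by rewrite leq_eqVlt ltnNge pdiv_leq ?orbF; [move=> /eqP dE; rewrite dE pdiv_prime | lia].
(* When [d] is tried again, fuel is spent without advancing; dividing [n] by at least 3
   compensates. *)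
have lt' : [Nat (n / d)] < ([Nat d] + 2 * f) ^ 2.
  have : 3 * [Nat (n / d)] < ([Nat d] + 2 * f + 2) ^ 2.
    apply: leq_ltn_trans (_ : [Nat n] < _); first by rewrite nE mulnC leq_mul2l; lia.
    by rewrite (_ : [Nat d] + 2 * f + 2 = [Nat d] + 2 * f.+1) //; lia.
  have : 3 <= [Nat d] + 2 * f by lia.
  move: ([Nat d] + 2 * f) ([Nat (n / d)]) => x y x3; rewrite -!mulnn => h.
  have : 3 * x <= x * x by rewrite leq_mul2r x3 orbT.
  lia.
rewrite to_nat_dvd //; case: ifP => dn'.
  have [ul inl] := IH d _ d3 od n'0 on' (fun p pp pn' => big p pp (dvdn_trans pn' n'n)) lt'.
  split=> // p; rewrite inl nE; case pp: (prime p) => //=; rewrite Euclid_dvdM //.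
  case: (boolP (p %| [Nat d])) => pd'; rewrite ?orbF // orbT.
  by move: pd'; rewrite dvdn_prime2 // => /eqP ->.
have [||ul inl] := IH (d + 2)%num (n / d)%num _ odS n'0 on' (bigS _ n'n (negbT dn')).
- lia.
- by apply: leq_trans lt' _; rewrite leq_exp2r //; lia.
split=> [|p] /=.
  by rewrite ul inl pd dn'.
rewrite inE inl nE; case pp: (prime p) => /=; last first.
  by apply/negP => /orP[/eqP E|//]; rewrite E pd in pp.
by rewrite Euclid_dvdM // orbC; congr (_ || _); rewrite dvdn_prime2.
Qed.

Fixpoint pos_odd_part (p : positive) : positive :=
  if p is xO p' then pos_odd_part p' else p.

Lemma pos_odd_partP p : exists k, Pos.to_nat p = 2 ^ k * Pos.to_nat (pos_odd_part p) /\
  odd (Pos.to_nat (pos_odd_part p)).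
Proof.
elim: p => [p _|p [k [pE op]]|]; rewrite [pos_odd_part _]/=; last by exists 0.
  exists 0; rewrite mul1n Pos2Nat.inj_xI; split=> //.
  by rewrite -[odd _]/(~~ odd (2 * Pos.to_nat p)) oddM.
by exists k.+1; rewrite expnS -mulnA -pE Pos2Nat.inj_xO.
Qed.

(** Fuel 60 from the divisor 3 suffices below [(3 + 2 * 60) ^ 2 = 123 ^ 2]. *)
Definition odd_factors (n : N) : seq N :=
  if n is Npos p then trial_division 60 3 (Npos (pos_odd_part p)) else [::].

Lemma odd_factorsP n : 0 < [Nat n] < 123 ^ 2 ->
    let l := map N.to_nat (odd_factors n) in
  uniq l /\ (forall p, (p \in l) = [&& prime p, odd p & p %| [Nat n]]).
Proof.
case: n => [//|n] /andP[_ lt]; have [k [nE on]] := pos_odd_partP n.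
have [|||||ul inl] := @trial_divisionP 60 3 (Npos (pos_odd_part n)) _ _ _ on _ _.
- by [].
- by [].
- by rewrite /=; lia.
- move=> p pp pn; case: p pp pn => [|[|[|p]]] // _ /dvdn_odd/(_ on) //.
- apply: leq_trans lt; rewrite ltnS /= nE leq_pmull // expn_gt0 //.
split=> // p; rewrite inl /= nE; case pp: (prime p) => //=.
apply/idP/andP=> [pn|[op]]; first by rewrite (dvdn_odd pn on) dvdn_mull.
by rewrite Gauss_dvdr // coprimeXr // coprimen2.
Qed.

Fixpoint prodN (s : seq N) : N := if s is p :: s' then (p * prodN s')%num else 1%num.

Fixpoint sieve_denN (s : seq N) : N :=
  if s is p :: s' then (prodN s' + p * sieve_denN s')%num else 0%num.

Definition sieve_costN (q T U r p : N) : N :=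
  (if (q + 1) mod p =? 0 then (T - U) * r + U else T * r)%num.

Fixpoint sieve_errN (q T U r : N) (s : seq N) : N :=
  if s is p :: s' then
    ((p - 1) * sieve_costN q T U r p * prodN s' + p * sieve_errN q T U r s')%num
  else 0%num.

Definition core_sizeN (C : seq N) : N := foldr (fun _ a => 2 * a)%num 4%num C.
Definition core_trivN (q : N) (C : seq N) : N :=
  foldr (fun p a => if (q + 1) mod p =? 0 then 2 * a else a)%num
    (if (q + 1) mod 4 =? 0 then 4 else 2)%num C.

Definition sieve_ineqN (q r : N) (C S : seq N) : bool :=
  let T := core_sizeN C in let U := core_trivN q C in
  (sieve_errN q T U r S <? (prodN S - sieve_denN S) * (q - ((T - U) * r + (U - 1))))%num.

Lemma dvdS_to_nat q p : 0 < [Nat p] ->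
  ((q + 1) mod p =? 0)%num = ([Nat p] %| [Nat q].+1).
Proof. by move=> p0; rewrite to_nat_dvd ?N2Nat.inj_add ?addn1 //; lia. Qed.

Lemma prodN_to_nat s : [Nat (prodN s)] = \prod_(p <- map N.to_nat s) p.
Proof. by elim: s => [|p s IH] /=; rewrite ?big_nil // big_cons -IH; lia. Qed.

Lemma sieve_denN_to_nat s : [Nat (sieve_denN s)] = sieve_den (map N.to_nat s).
Proof. by elim: s => [|p s IH] //=; rewrite -IH -prodN_to_nat; lia. Qed.

Lemma sieve_errN_to_nat q T U r s : all (leq 1) (map N.to_nat s) ->
  [Nat (sieve_errN q T U r s)] =
  sieve_err [Nat q] [Nat T] [Nat U] [Nat r] (map N.to_nat s).
Proof.
elim: s => [|p s IH] //= /andP[p0 /IH {}IH]; rewrite -IH -prodN_to_nat /sieve_cost /sieve_costN.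
by rewrite dvdS_to_nat //; case: ifP => _; lia.
Qed.

Lemma core_sizeN_to_nat C : [Nat (core_sizeN C)] = core_size (map N.to_nat C).
Proof.
rewrite /core_size; elim: C => [|p C IH] //.
have -> : core_sizeN (p :: C) = (2 * core_sizeN C)%num by [].
rewrite N2Nat.inj_mul IH.
by rewrite [size _]/= expnS mulnCA.
Qed.

Lemma core_trivN_to_nat q C : all (leq 1) (map N.to_nat C) ->
  [Nat (core_trivN q C)] = core_triv [Nat q] (map N.to_nat C).
Proof.
rewrite /core_triv; elim: C => [_|p C IH].
  by rewrite /core_trivN [foldr _ _ _]/= (@dvdS_to_nat q 4) //; case: ifP.
case/andP=> p0 /IH {}IH.
have -> : core_trivN q (p :: C) =
  (if (q + 1) mod p =? 0 then 2 * core_trivN q C else core_trivN q C)%num by [].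
rewrite dvdS_to_nat // [count _ _]/=; case: ([Nat p] %| _) => //.
by rewrite N2Nat.inj_mul IH add1n expnS mulnCA.
Qed.

Lemma sieve_ineqN_to_nat q r C S : all (leq 1) (map N.to_nat (C ++ S)) ->
  sieve_ineqN q r C S = sieve_ineq [Nat q] [Nat r] (map N.to_nat C) (map N.to_nat S).
Proof.
rewrite map_cat all_cat => /andP[aC aS]; rewrite /sieve_ineqN /sieve_ineq.
rewrite -core_sizeN_to_nat -core_trivN_to_nat // -sieve_errN_to_nat //.
rewrite -prodN_to_nat -sieve_denN_to_nat.
set e := sieve_errN _ _ _ _ _; set T := core_sizeN C; set U := core_trivN q C.
set P := prodN S; set d := sieve_denN S; rewrite -subn1.
have -> : ([Nat P] - [Nat d]) * ([Nat q] - (([Nat T] - [Nat U]) * [Nat r] + ([Nat U] - 1))) =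
   [Nat ((P - d) * (q - ((T - U) * r + (U - 1))))].
  by rewrite N2Nat.inj_mul !N2Nat.inj_sub N2Nat.inj_add N2Nat.inj_mul !N2Nat.inj_sub.
move: (_ * _)%num => x; case: N.ltb_spec; lia.
Qed.

(** Factoring [q - 1] and [q + 1] separately keeps the numbers within range; they share no odd
    prime. *)
Definition odd_factors_sq (q : N) : seq N := odd_factors (q - 1) ++ odd_factors (q + 1).

Lemma odd_factors_sqP q : odd [Nat q] -> 1 < [Nat q] < 122 ^ 2 ->
    let l := map N.to_nat (odd_factors_sq q) in
  uniq l /\ (forall p, (p \in l) = odd_prime_divisor [Nat q] p).
Proof.
move=> oq /andP[q1 qlt].
have qS : [Nat (q + 1)] = [Nat q] + 1 by lia.
have [|u1 in1] := @odd_factorsP (q - 1).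
  rewrite N2Nat.inj_sub subn_gt0 q1 (leq_ltn_trans (leq_subr _ _)) //.
  by rewrite (ltn_trans qlt) // ltn_exp2r.
have [|u2 in2] := @odd_factorsP (q + 1).
  by rewrite qS addn1 /=; apply: leq_ltn_trans qlt _; rewrite ltn_exp2r.
rewrite /odd_factors_sq map_cat; split=> [|p].
  rewrite cat_uniq u1 u2 andbT; apply/hasPn => p; rewrite in2 in1 => /and3P[pp op pq].
  rewrite pp op /=; apply/negP => pq'.
  have : p %| 2.
    have -> : 2 = [Nat (q + 1)] - [Nat (q - 1)] by lia.
    exact: dvdn_sub.
  by rewrite dvdn_prime2 // => /eqP p2; rewrite p2 in op.
rewrite mem_cat in1 in2 /odd_prime_divisor; case pp: (prime p) => //=; case: (odd p) => //=.
have -> : [Nat q] ^ 2 - 1 = ([Nat q] - 1) * ([Nat q] + 1) by rewrite -subn_sqr exp1n.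
by rewrite Euclid_dvdM // N2Nat.inj_sub qS.
Qed.

(** Two cores are tried: the empty one, and the prime 3 when it divides [q ^ 2 - 1]. *)
Definition sieve_test (q : N) : bool :=
  let l := odd_factors_sq q in let r := N.sqrt_up q in
  let is3 p := (p =? 3)%num in
  (q <=? r * r)%num &&
  (sieve_ineqN q r [::] l || sieve_ineqN q r (filter is3 l) (filter (predC is3) l)).

Lemma sieve_testP q : odd [Nat q] -> 1 < [Nat q] < 122 ^ 2 -> sieve_test q ->
  two_primitive_lines [Nat q].
Proof.
move=> oq qb; have [ul inl] := odd_factors_sqP oq qb.
rewrite /sieve_test; set l := odd_factors_sq q in ul inl *.
move: (N.sqrt_up q) => r /andP[/N.leb_le qr].
have {}qr : [Nat q] <= [Nat r] ^ 2 by rewrite -mulnn; lia.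
have sieve C S : perm_eq (C ++ S) l -> sieve_ineqN q r C S -> two_primitive_lines [Nat q].
  move=> /(perm_map N.to_nat) pm; have memE := perm_mem pm.
  have pos : all (leq 1) (map N.to_nat (C ++ S)).
    by apply/allP=> p; rewrite memE inl => /and3P[/prime_gt0].
  rewrite sieve_ineqN_to_nat // => ineq; apply: sieve_lines oq _ _ _ qr ineq; rewrite -map_cat.
  - by apply/allP=> p; rewrite memE inl.
  - by rewrite (perm_uniq pm).
  by move=> p; rewrite memE inl.
case/orP; apply: sieve => //; by rewrite perm_filterC.
Qed.

(** The first alternative discards odd numbers that are not prime powers. *)
Definition small_test (exc : seq N) (q : N) : bool :=
  [|| size (odd_factors q) != 1, sieve_test q | has (N.eqb q) exc].

Fixpoint all_odd_from (f : nat) (test : N -> bool) (q : N) : bool :=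
  if f is f'.+1 then test q && all_odd_from f' test (q + 2)%num else true.

Lemma all_odd_fromP f test q : all_odd_from f test q ->
  forall i, i < f -> test (q + 2 * N.of_nat i)%num.
Proof.
elim: f q => [|f IH] q //= /andP[tq /IH tqs] [|i] lti; first by rewrite /= N.add_0_r.
have -> : (q + 2 * N.of_nat i.+1 = q + 2 + 2 * N.of_nat i)%num by lia.
exact: tqs.
Qed.

Lemma odd_factors_prime_power q : odd_prime_power [Nat q] -> [Nat q] < 123 ^ 2 ->
  size (odd_factors q) = 1.
Proof.
move=> [oq [p [k [pp k0 qE]]]] qlt.
have [|ul inl] := @odd_factorsP q; first by rewrite qE expn_gt0 prime_gt0 // -qE.
have op : odd p by move: oq; rewrite qE oddX => /orP[/eqP k0'|//]; rewrite k0' in k0.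
rewrite -(size_map N.to_nat); apply/eqP; rewrite -(@uniq_size_uniq _ [:: p]) // => x.
rewrite inl inE qE; apply/eqP/and3P => [->|[px ox]].
  by split=> //; rewrite dvdn_exp.
by rewrite Euclid_dvdX // => /andP[]; rewrite dvdn_prime2 // => /eqP.
Qed.

(* The pair [(p, cs)] describes the field with [p ^ size cs] elements generated
   by a root of ['X^k - \sum_(i < k) cs`_i *: 'X^i], where [k = size cs]. *)
Definition explicit_fields : seq (N * seq N) := [::
  (17, [:: 3]); (19, [:: 2]); (23, [:: 7]); (5, [:: 2; 3]); (3, [:: 2; 1; 2]);
  (29, [:: 3]); (37, [:: 5]); (43, [:: 3]); (47, [:: 13]); (7, [:: 2; 2]);
  (53, [:: 5]); (59, [:: 2]); (61, [:: 2]); (67, [:: 12]); (71, [:: 11]);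
  (73, [:: 11]); (79, [:: 3]); (3, [:: 1; 0; 0; 1]); (83, [:: 2]);
  (89, [:: 6]); (97, [:: 5]); (101, [:: 3]); (103, [:: 5]); (109, [:: 6]);
  (113, [:: 10]); (11, [:: 4; 1]); (5, [:: 2; 1; 0]); (127, [:: 3]);
  (131, [:: 14]); (137, [:: 6]); (139, [:: 2]); (149, [:: 3]); (151, [:: 12]);
  (157, [:: 6]); (13, [:: 2; 4]); (173, [:: 5]); (181, [:: 18]);
  (191, [:: 19]); (197, [:: 3]); (199, [:: 6]); (211, [:: 3]); (229, [:: 6]);
  (233, [:: 3]); (239, [:: 13]); (241, [:: 13]); (269, [:: 2]); (281, [:: 3]);
  (307, [:: 5]); (311, [:: 17]); (331, [:: 11]); (337, [:: 15]);
  (349, [:: 2]); (19, [:: 5; 1]); (373, [:: 6]); (379, [:: 10]);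
  (389, [:: 8]); (409, [:: 22]); (419, [:: 2]); (421, [:: 18]); (461, [:: 2]);
  (463, [:: 11]); (491, [:: 8]); (509, [:: 2]); (521, [:: 6]);
  (23, [:: 2; 6]); (569, [:: 3]); (571, [:: 3]); (601, [:: 11]);
  (617, [:: 26]); (631, [:: 12]); (659, [:: 10]); (661, [:: 2]);
  (701, [:: 3]); (761, [:: 7]); (769, [:: 21]); (29, [:: 2; 2]);
  (859, [:: 2]); (881, [:: 15]); (911, [:: 37]); (1009, [:: 11]);
  (1021, [:: 10]); (1231, [:: 23]); (1289, [:: 11]); (1301, [:: 10]);
  (11, [:: 2; 0; 2]); (1429, [:: 33]); (1481, [:: 3]); (1609, [:: 21]);
  (1709, [:: 23]); (1741, [:: 2]); (43, [:: 13; 3]); (1861, [:: 2]);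
  (2029, [:: 2]); (2281, [:: 56]); (2311, [:: 11]); (2521, [:: 17]);
  (2729, [:: 28]); (3541, [:: 18])
]%num.

Definition field_size (f : N * seq N) : N := (f.1 ^ N.of_nat (size f.2))%num.

Definition sieve_exceptions : seq N :=
  [:: 3; 5; 7; 9; 11; 13; 31; 41]%num ++ map field_size explicit_fields.

(** These are the 7320 odd numbers from 3 to [14641 = 121 ^ 2]. *)
Lemma sieve_test_all : all_odd_from (120 * 61) (small_test sieve_exceptions) 3.
Proof. by vm_compute. Qed.

Lemma prime_power_lines q : odd_prime_power q ->
  has (N.eqb (N.of_nat q)) sieve_exceptions \/ two_primitive_lines q.
Proof.
move=> oq; have [o _] := oq.
have q3 : 3 <= q.
  by case: oq => o' [p [k [pp k0 qE]]]; case: q o qE {o'} => [|[|[|]]] // _ /esym/eqP;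
    rewrite -(exp1n k) eqn_exp2r // => /eqP p1; rewrite p1 in pp.
have [qs|ql] := leqP q (121 ^ 2); last by right; apply: large_q_lines.
have qE : [Nat (N.of_nat q)] = q by rewrite Nat2N.id.
have q_lt : q < 122 ^ 2 by apply: leq_ltn_trans qs _; rewrite ltn_exp2r.
have := all_odd_fromP sieve_test_all (i := q./2.-1).
have -> : (3 + 2 * N.of_nat q./2.-1)%num = N.of_nat q by lia.
case/(_ _)/or3P; first by lia.
- rewrite odd_factors_prime_power // qE // (ltn_trans q_lt) // ltn_exp2r //.
- by move/sieve_testP; rewrite qE => h; right; apply: h => //; rewrite q_lt ltnW.
by left.
Qed.

(** * Logarithms of a line in an explicit field *)

Section ExplicitGenerator.

Local Open Scope ring_scope.

Variables (F K : finFieldType) (emb : {rmorphism F -> K}).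
Hypothesis cardK : #|K| = (#|F| ^ 2)%N.
Local Notation q := #|F|.
Local Notation n := (#|F| ^ 2 - 1)%N.
Hypothesis q_odd : odd q.

Lemma expf_order_sub (x : F) : x != 0 -> x ^+ (q - 1) = 1.
Proof.
move=> x0; apply: (mulfI x0).
by rewrite -exprS mulr1 subn1 prednK ?expf_card // ltnW ?q_gt1.
Qed.

(** The order of a nonzero [emb x] divides [q - 1], so its logarithm is a multiple of the even
    number [q + 1]. *)
Lemma sqrt_emb (x : F) : exists z : K, z ^+ 2 = emb x.
Proof.
have [->|x0] := eqVneq x 0; first by exists 0; rewrite rmorph0 expr0n.
have [g pg] := finField_prim_root K; rewrite cardK -subn1 in pg.
have ex0 : emb x != 0 by rewrite fmorph_eq0.
have xE := dlogK cardK pg ex0; set s := dlog F g (emb x) in xE.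
have : g ^+ (s * (q - 1)) == 1 by rewrite exprM xE -rmorphXn expf_order_sub ?rmorph1.
rewrite -(prim_order_dvd pg) orderE mulnC dvdn_pmul2r ?subn_gt0 ?q_gt1 // => qs.
have s2 : (2 %| s)%N by apply: dvdn_trans qs; rewrite dvdn2 oddD q_odd.
by exists (g ^+ (s %/ 2)%N); rewrite -exprM divnK.
Qed.

Lemma exists_quadratic_root (w : F) :
  2%:R != 0 :> F -> exists g : K, g ^+ 2 = g - emb w.
Proof.
move=> two0; have [z zE] := sqrt_emb (1 - 4%:R * w).
have {}two0 : 2%:R != 0 :> K by rewrite -(rmorph_nat emb) fmorph_eq0.
exists ((1 + z) / 2%:R); apply: (mulfI (mulf_neq0 two0 two0)).
have -> : 2%:R * 2%:R * ((1 + z) / 2%:R) ^+ 2 = (1 + z) ^+ 2 by field.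
have -> : 2%:R * 2%:R * ((1 + z) / 2%:R - emb w) = 2%:R + 2%:R * z - 4%:R * emb w.
  by field.
have {}zE : z ^+ 2 = 1 - 4%:R * emb w.
  by rewrite zE rmorphB rmorph1 rmorphM rmorph_nat.
by rewrite sqrrD zE expr1n mul1r; ring.
Qed.

Variables (w : F) (g : K) (b : nat -> F).
Hypothesis g_sq : g ^+ 2 = g - emb w.
Hypotheses (b_0 : b 0 = 0) (b_1 : b 1 = 1).
Hypothesis b_rec : forall i, b i.+2 = b i.+1 - w * b i.
Hypotheses (b_q : b q = -1) (b_q1 : b q.+1 = 0).
Hypothesis w_order : w ^+ (q - 1) = 1.
Hypothesis w_prim : forall j, (0 < j < q - 1)%N -> w ^+ j != 1.
Hypothesis b_pow : forall i, (0 < i <= q)%N -> exists2 j, (j <= q - 1)%N & b i = w ^+ j.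

(** The [b i] form the Lucas sequence of [X^2 - X + w]. *)
Lemma gen_pow i : g ^+ i.+1 = emb (- (w * b i)) + emb (b i.+1) * g.
Proof.
elim: i => [|i IH]; first by rewrite b_0 b_1 mulr0 oppr0 rmorph0 rmorph1 mul1r add0r.
rewrite exprS IH b_rec mulrDr mulrCA -expr2 g_sq !rmorphB !rmorphN !rmorphM; ring.
Qed.

Lemma gen_norm : g ^+ q.+1 = emb w.
Proof. by rewrite gen_pow b_q b_q1 rmorph0 mul0r addr0 mulrN1 opprK. Qed.

Let q_gt2 : (2 < q)%N.
Proof. by have := q_gt1 F; case: (ltngtP 2 q) => // q2; move: q_odd; rewrite -q2. Qed.

Let w_neq0 : w != 0.
Proof.
apply/eqP=> w0; move/eqP: w_order; rewrite w0 expr0n eq_sym.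
by rewrite gtn_eqF ?oner_eq0 // subn_gt0 ltnW.
Qed.

(* If [g] were in the small field, [w = g ^+ q.+1] would be the square of [g],
   contradicting that [w] generates the multiplicative group. *)
Lemma gen_out x : g != emb x.
Proof.
apply/eqP=> gx; have wE : w = x ^+ 2.
  apply: (fmorph_inj emb); rewrite -gen_norm gx -rmorphXn; congr (emb _).
  by rewrite exprS expf_card.
have x0 : x != 0 by apply: contraNneq w_neq0 => x0; rewrite wE x0 expr0n.
have q2 : (q - 1 = 2 * (q - 1)./2)%N.
  by rewrite mul2n even_halfK // oddB ?q_odd // ltnW // ltnW.
have jq : (0 < (q - 1)./2 < q - 1)%N by move: q_gt2 q2; lia.
by have := w_prim jq; rewrite wE -exprM -q2 expf_order_sub // eqxx.
Qed.

Let emb_coords a c a' c' : emb a + emb c * g = emb a' + emb c' * g -> a = a' /\ c = c'.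
Proof.
rewrite addrC [RHS]addrC => E.
by have [-> ->] := @line_coords_inj F K emb g gen_out (c, a) (c', a') E.
Qed.

Let gen_split s : g ^+ s = g ^+ (s %% q.+1) * emb (w ^+ (s %/ q.+1)).
Proof. by rewrite {1}(divn_eq s q.+1) addnC exprD mulnC exprM gen_norm -rmorphXn. Qed.

Let w_pow_dvd j : w ^+ j = 1 -> (q - 1 %| j)%N.
Proof.
have q10 : (0 < q - 1)%N by rewrite subn_gt0 ltnW.
rewrite {1}(divn_eq j (q - 1)) exprD mulnC exprM w_order expr1n mul1r => wj.
rewrite /dvdn -leqn0 leqNgt; apply/negP => j0.
by have := w_prim (j := (j %% (q - 1))%N); rewrite j0 ltn_mod q10 wj eqxx => /(_ isT).
Qed.

Let pow_coords i a : (0 < i <= q)%N -> exists2 j, (j <= q - 1)%N &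
  g ^+ i * emb a = emb (- (w * b i.-1) * a) + emb (w ^+ j * a) * g.
Proof.
move=> iq; have [j jq bj] := b_pow iq; exists j => //.
case: i iq bj => // i _ bj; rewrite gen_pow -bj /= !rmorphM; ring.
Qed.

(** Let [m] be the order of [g] and [i] its residue modulo [q + 1]. If [i > 0], then [b i] is a
    power of [w], so [g ^+ m] has a nonzero coordinate along [g] and is not 1. Hence [i = 0], and
    [w] having order [q - 1] gives the rest. *)
Lemma gen_prim : n.-primitive_root g.
Proof.
have g0 : g != 0 by rewrite -(rmorph0 emb) gen_out.
have [m pm mn] := prim_order_exists (order_gt0 F) (expf_order cardK g0).
suff <- : m = n by [].
apply/eqP; rewrite eqn_dvd mn /= orderE addn1.
have := prim_expr_order pm; rewrite gen_split.
have rq : (m %% q.+1 <= q)%N by rewrite -ltnS ltn_mod.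
case: (posnP (m %% q.+1)) => [r0|r0].
  rewrite r0 mul1r => /eqP; rewrite fmorph_eq1 => /eqP/w_pow_dvd d.
  by rewrite (divn_eq m q.+1) r0 addn0 dvdn_mul.
have [|j _ ->] := @pow_coords (m %% q.+1) (w ^+ (m %/ q.+1)); first by rewrite r0.
move=> E; have /emb_coords[_ /eqP] : emb (- (w * b (m %% q.+1).-1) * w ^+ (m %/ q.+1)) +
     emb (w ^+ j * w ^+ (m %/ q.+1)) * g = emb 1 + emb 0 * g.
  by rewrite E rmorph1 rmorph0 mul0r addr0.
by rewrite mulf_eq0 !expf_eq0 (negPf w_neq0) !andbF.
Qed.

(** Dividing [g ^+ i] by its coordinate [b i] along [g] lands on the line; this is multiplication by
    [w ^+ (q - 1 - j)], where [w = g ^+ q.+1]. *)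
Lemma line_log i j : (0 < i <= q)%N -> (j <= q - 1)%N -> b i = w ^+ j ->
  exists x, g ^+ (i + q.+1 * (q - 1 - j)) = g + emb x.
Proof.
move=> iq jq bj; case: i iq bj => // i _ bj.
exists (- (w * b i) * w ^+ (q - 1 - j)).
rewrite exprD exprM gen_norm gen_pow mulrDl -rmorphXn -!rmorphM mulrAC -!rmorphM bj.
by rewrite -exprD subnKC // w_order rmorph1 mul1r addrC.
Qed.

(** Conversely, with [i] the residue of [s] modulo [q + 1], the coordinate 1 along [g] forces
    [i > 0] and the cofactor of [g ^+ i] to be the inverse of [b i]. *)
Lemma line_log_unique x s : g ^+ s = g + emb x ->
  exists i, (0 < i <= q)%N /\ forall j, (j <= q - 1)%N -> b i = w ^+ j ->
    (s = i + q.+1 * (q - 1 - j) %[mod n])%N.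
Proof.
rewrite gen_split; set i := (s %% q.+1)%N; set a := (s %/ q.+1)%N => E.
have iq : (i <= q)%N by rewrite -ltnS ltn_mod.
case: (posnP i) => [i0|i0].
  exfalso; move: E; rewrite i0 mul1r => E.
  have /emb_coords[_ /eqP] : emb (w ^+ a) + emb 0 * g = emb x + emb 1 * g.
    by rewrite E rmorph0 rmorph1 mul0r addr0 mul1r addrC.
  by rewrite eq_sym oner_eq0.
exists i; rewrite i0 iq; split=> // j jq bj.
have wa : w ^+ j * w ^+ a = 1.
  move: E; rewrite -bj; case: i i0 {iq bj} => // i _.
  rewrite gen_pow mulrDl -rmorphM mulrAC -rmorphM.
  move=> E; have /emb_coords[_ ->//] : emb (- (w * b i) * w ^+ a) + emb (b i.+1 * w ^+ a) * g =
     emb x + emb 1 * g by rewrite E rmorph1 mul1r addrC.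
apply/eqP; rewrite -(eq_prim_root_expr gen_prim) (divn_eq s q.+1) addnC -/i -/a.
rewrite [(a * _)%N]mulnC (exprD _ i (q.+1 * a)) (exprD _ i (q.+1 * (q - 1 - j))).
rewrite !exprM gen_norm -!rmorphXn; apply/eqP; congr (_ * emb _).
have wj0 : w ^+ j != 0 by rewrite expf_neq0.
by apply: (mulfI wj0); rewrite wa -exprD subnKC.
Qed.

End ExplicitGenerator.

Lemma explicit_lines (F K : finFieldType) (emb : {rmorphism F -> K}) (g : K) (D C : seq nat) :
    #|K| = #|F| ^ 2 -> odd #|F| ->
    ((#|F| ^ 2 - 1).-primitive_root g)%R -> (forall x, g != emb x) ->
    (forall d, d \in D -> exists x, g ^+ d = g + emb x)%R ->
    (forall p, odd_prime_divisor #|F| p -> p \in C) ->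
    (forall t, exists2 d, d \in D & hits C (t + d)) ->
  forall alpha theta : K, (alpha != 0)%R -> (forall x, theta != emb x) ->
  exists x, (((#|F| ^ 2 - 1) %/ 2).-primitive_root (alpha * (theta + emb x)))%R.
Proof.
move=> cardK q_odd pg gen_out D_line inC hitD alpha theta a0 th.
have [[a c] /= gE] := line_coords cardK th g.
have ea0 : (emb a != 0)%R.
  by apply/eqP=> ea; have /eqP[] := gen_out c; rewrite gE ea mul0r add0r.
have aa0 : (alpha / emb a != 0)%R by rewrite mulf_neq0 ?invr_eq0.
have [d dD hd] := hitD (dlog F g (alpha / emb a)%R).
have [x gx] := D_line d dD.
(* Since [g = a * theta + c], this choice turns the element into [(alpha / a) * (g + x)]. *)
exists ((c + x) / a)%R.
have -> : (alpha * (theta + emb ((c + x) / a)) = g ^+ (dlog F g (alpha / emb a) + d))%R.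
  rewrite exprD (dlogK cardK pg aa0) gx gE rmorphM rmorphD fmorphV; field.
  by rewrite ea0.
by rewrite -{2}(hits_gcdn q_odd inC hd) exp_prim_root.
Qed.

(* [cs] stands for the polynomial ['X^k - \sum_(i < k) cs`_i *: 'X^i] with
   [k = size cs]; the list [l] stands for [\sum_i l`_i * w ^+ i] where [w] is a
   root of that polynomial in a ring of characteristic [p]. *)
Section Representation.

Variables (p : N) (cs : seq N).

Definition reduceN (x : N) : N := (if x <? p then x else x mod p)%num.

Fixpoint axpy (t : N) (cs l : seq N) : seq N :=
  match cs, l with
  | c :: cs', x :: l' => reduceN (c * t + x)%num :: axpy t cs' l'
  | _, _ => [::]
  end.

(** Coefficients are shifted up by one; the last one, now at [w ^+ k], is folded back through
    [cs]. *)
Definition rmulw (l : seq N) : seq N := axpy (last 0%num l) cs (0%num :: l).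

(* The last case never occurs on reduced representatives. *)
Definition subN (a b : N) : N :=
  (if b <=? a then a - b else if b <=? a + p then a + p - b else a + (p - 1) * b)%num.

Fixpoint rsub (l m : seq N) : seq N :=
  match l, m with
  | a :: l', b :: m' => subN a b :: rsub l' m'
  | _, _ => [::]
  end.

Definition rzero : seq N := nseq (size cs) 0%num.
Definition rone : seq N := 1%num :: nseq (size cs).-1 0%num.

Section Evaluation.

Local Open Scope ring_scope.

Variables (R : fieldType) (w : R).
Hypothesis charRp : [Nat p] \in [pchar R].

Definition reval (l : seq N) : R := foldr (fun x a => [Nat x]%:R + w * a) 0 l.

Hypothesis w_root : w ^+ size cs = reval cs.

Let p_gt0 : (0 < p)%num.
Proof. by have /prime_gt0 := pcharf_prime charRp; clear; lia. Qed.

Lemma natr_reduceN x : [Nat (reduceN x)]%:R = [Nat x]%:R :> R.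
Proof.
rewrite /reduceN; case: ifP => // _; have [-> _] := to_nat_divmod x p_gt0.
by rewrite {2}(divn_eq [Nat x] [Nat p]) natrD natrM (pcharf0 charRp) mulr0 add0r.
Qed.

Lemma natr_subN a b : [Nat (subN a b)]%:R = [Nat a]%:R - [Nat b]%:R :> R.
Proof.
apply/eqP; rewrite eq_sym subr_eq -natrD eq_sym /subN.
case: N.leb_spec => h1.
  by rewrite (_ : ([Nat (a - b)] + [Nat b])%N = [Nat a]) //; lia.
case: N.leb_spec => h2.
  rewrite (_ : ([Nat (a + p - b)] + [Nat b])%N = [Nat a] + [Nat p])%N; last by lia.
  by rewrite natrD (pcharf0 charRp) addr0.
rewrite (_ : ([Nat (a + (p - 1) * b)] + [Nat b])%N = [Nat a] + [Nat p] * [Nat b])%N.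
  by rewrite natrD natrM (pcharf0 charRp) mul0r addr0.
have -> : [Nat p] = ([Nat (p - 1)] + 1)%N by move: p_gt0; lia.
by move: (p - 1)%num => r; lia.
Qed.

Lemma reval_rcons l x : reval (rcons l x) = reval l + w ^+ size l * [Nat x]%:R.
Proof.
elim: l => [|y l IH] /=; first by rewrite mulr0 addr0 add0r mul1r.
by rewrite IH mulrDr addrA mulrA -exprS.
Qed.

Lemma reval_axpy t c l : (size c <= size l)%N ->
  size (axpy t c l) = size c /\
  reval (axpy t c l) = reval c * [Nat t]%:R + reval (take (size c) l).
Proof.
elim: c l => [|c cs' IH] [|x l] //=; rewrite ?mul0r ?addr0 // => /IH[-> ->]; split=> //.
rewrite natr_reduceN N2Nat.inj_add N2Nat.inj_mul natrD natrM; ring.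
Qed.

Lemma reval_mulw l : size l = size cs ->
  size (rmulw l) = size cs /\ reval (rmulw l) = w * reval l.
Proof.
move=> sl; rewrite /rmulw; have [|-> ->] := @reval_axpy (last 0%num l) cs (0%num :: l).
  by rewrite /= sl leqW.
split=> //; transitivity (reval (0%num :: l)); last by rewrite /= add0r.
rewrite lastI reval_rcons size_belast sl w_root addrC; congr (_ + _).
by rewrite -cats1 take_cat size_belast sl ltnn subnn cats0.
Qed.

Lemma reval_sub l m : size l = size m ->
  size (rsub l m) = size m /\ reval (rsub l m) = reval l - reval m.
Proof.
elim: l m => [|a l IH] [|b m] //=; first by rewrite subr0.
by case=> /IH[-> ->]; rewrite natr_subN; split=> //; ring.
Qed.

Lemma reval0 : size rzero = size cs /\ reval rzero = 0.
Proof.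
split; first by rewrite size_nseq.
by rewrite /rzero; elim: (size cs) => //= k ->; rewrite mulr0 addr0.
Qed.

Hypothesis k_gt0 : (0 < size cs)%N.

Lemma reval1 : size rone = size cs /\ reval rone = 1.
Proof.
rewrite /rone; split; first by rewrite /= size_nseq prednK.
rewrite /= (_ : reval _ = 0) ?mulr0 ?addr0 //.
by elim: _.-1 => //= k; rewrite /reval /= => ->; rewrite mulr0 addr0.
Qed.

Lemma reval_iter j : size (iter j rmulw rone) = size cs /\ reval (iter j rmulw rone) = w ^+ j.
Proof.
elim: j => [|j [sj ej]]; first by have [-> ->] := reval1.
by rewrite iterS exprS -ej; apply: reval_mulw.
Qed.

End Evaluation.

Definition rkey (l : seq N) : positive :=
  N.succ_pos (foldr (fun x a => x + p * a)%num 0%num l).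

Fixpoint log_table (j : N) (hs : seq (seq N)) (m : PositiveMap.t (N * seq N)) :
    PositiveMap.t (N * seq N) :=
  if hs is c :: hs' then
    log_table (j + 1)%num hs' (PositiveMap.add (rkey c) (j, c) m)
  else m.

Lemma log_tableP j hs m k i c : PositiveMap.find k (log_table j hs m) = Some (i, c) ->
  PositiveMap.find k m = Some (i, c) \/
  exists2 a, a < size hs & i = (j + N.of_nat a)%num /\ c = nth [::] hs a.
Proof.
elim: hs j m => [|h hs IH] j m /=; first by left.
case/IH => [|[a lta [-> ->]]]; last by right; exists a.+1 => //; split=> //; lia.
rewrite PositiveMapAdditionalFacts.gsspec; case: PositiveMap.E.eq_dec => _; last by left.
by case=> <- <-; right; exists 0 => //; split=> //; lia.
Qed.

(** The stored representative is compared with [b], so an answer is correct whatever the keys. *)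
Definition rlog (m : PositiveMap.t (N * seq N)) (b : seq N) : option N :=
  if PositiveMap.find (rkey b) m is Some (j, c) then
    if c == b then Some j else None
  else None.

Definition bstep (s : seq N * seq N) : seq N * seq N := (s.2, rsub s.2 (rmulw s.1)).

Fixpoint line_logs (q i : N) (m : PositiveMap.t (N * seq N)) (bs : seq (seq N * seq N)) :
    option (seq N) :=
  if bs is b :: bs' then
    if rlog m b.2 is Some j then
      if line_logs q (i + 1)%num m bs' is Some l then
        Some ((i + (q + 1) * (q - 1 - j))%num :: l)
      else None
    else None
  else Some [::].

(* The discrete logarithms of the elements of the line [g + F], where
   [g ^+ 2 = g - w] and [F] is the field generated by [w]. *)
Definition generator_line : option (seq N) :=
  let q := (p ^ N.of_nat (size cs))%num in
  let qn := N.to_nat q in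
  let hs := traject rmulw rone qn in
  let m := log_table 0 hs (PositiveMap.empty _) in
  let bs := traject bstep (rzero, rone) qn.+1 in
  if [&& 0 < size cs, odd qn, (p <? 123 * 123)%num, odd_factors p == [:: p],
      last [::] hs == rone,
      all (fun c => isSome (rlog m (rsub c rone))) (take (qn - 2) (behead hs))
    & last (rzero, rone) bs == (rsub rzero rone, rzero)]
  then line_logs q 1 m (take qn bs) else None.

End Representation.

(** * Covering all translates *)

Definition countN (m : PositiveMap.t N) (k : positive) : N :=
  if PositiveMap.find k m is Some c then c else 0%num.

(* For [m] empty and [mx = 0], the maximal number of elements of [L] in a residue
   class modulo [p]. *)
Fixpoint tally (p : N) (L : seq N) (m : PositiveMap.t N) (mx : N) : N :=
  if L is d :: L' then
    let k := N.succ_pos (d mod p)%num in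
    let c := (countN m k + 1)%num in
    tally p L' (PositiveMap.add k c m) (if mx <? c then c else mx)%num
  else mx.

Definition tally_bound (ps L : seq N) : N :=
  foldr (fun p a => tally p L (PositiveMap.empty _) 0 + a)%num 0%num ps.

(* Either the residue classes to be avoided cannot cover [L], or one branches
   on the class to be avoided modulo the first prime. *)
Fixpoint cover_test (ps L : seq N) : bool :=
  if (tally_bound ps L <? N.of_nat (size L))%num then true
  else if ps is p :: ps' then
    all (fun r => cover_test ps' (filter (fun d => ~~ (d mod p =? N.of_nat r)%num) L))
      (iota 0 (N.to_nat p))
  else false.

(** Sorting makes the search branch on the smallest primes first. *)
Definition explicit_test (f : N * seq N) : bool :=
  let q := field_size f in
  let ps := sort N.leb (odd_factors_sq q) in
  if generator_line f.1 f.2 is Some D then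
    (q <? 122 * 122)%num &&
    all (fun r => cover_test ps (filter (fun d => d mod 4 =? N.of_nat r)%num D)) (iota 0 4)
  else false.

Lemma tally_ge p L m mx : (forall k, countN m k <= mx)%num ->
  (mx <= tally p L m mx)%num /\
  forall k, (countN m k + N.of_nat (count (fun d => Pos.eqb (N.succ_pos (d mod p)) k) L)
             <= tally p L m mx)%num.
Proof.
elim: L m mx => [|d L IH] m mx mle /=.
  by split; [lia | move=> k; have := mle k; lia].
set k0 := N.succ_pos _; set c := (countN m k0 + 1)%num.
set mx' := (if _ then _ else _); set m' := PositiveMap.add _ _ _.
have mx'E : (mx <= mx' /\ c <= mx')%num by rewrite /mx'; case: N.ltb_spec; lia.
have m'E k : countN m' k = if Pos.eqb k0 k then c else countN m k.
  rewrite /countN /m' PositiveMapAdditionalFacts.gsspec.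
  case: PositiveMap.E.eq_dec => [->|/nesym/Pos.eqb_neq->] //.
  by rewrite Pos.eqb_refl.
have [|le1 le2] := IH m' mx'.
  by move=> k; rewrite m'E; case: ifP => _; [lia | have := mle k; lia].
split=> [|k]; first by lia.
have := le2 k; rewrite m'E; case: Pos.eqb_spec => [<-|_]; rewrite ?add0n //.
by rewrite /c; lia.
Qed.

Lemma dvd_residue p t d : 0 < p -> p %| t + d -> d %% p = (p - t %% p) %% p.
Proof.
move=> p0 td; apply/eqP; rewrite -(eqn_modDl t).
have -> : t + (p - t %% p) = (t %/ p).+1 * p.
  rewrite {1}(divn_eq t p) -addnA subnKC; last by rewrite ltnW ?ltn_mod.
  by rewrite mulSn addnC.
by rewrite modnMl.
Qed.

Lemma tally_count p L t : 0 < [Nat p] ->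
  count (fun d => [Nat p] %| t + [Nat d]) L <= [Nat (tally p L (PositiveMap.empty _) 0)].
Proof.
move=> p0; have [|_ le] := @tally_ge p L (PositiveMap.empty _) 0.
  by move=> k; rewrite /countN PositiveMap.gempty.
have := le (N.succ_pos (N.of_nat (([Nat p] - t %% [Nat p]) %% [Nat p]))).
rewrite /countN PositiveMap.gempty.
set c := count _ L => {}le; apply: (@leq_trans c); last by move: le; lia.
apply: sub_count => d /= /(dvd_residue p0) dE.
have pN : (0 < p)%num by lia.
have [mE _] := to_nat_divmod d pN.
by rewrite -dE -mE N2Nat.id Pos.eqb_refl.
Qed.

(** For each prime, [t] enters only through the class of [-t], which is the one to avoid. If every
    element were excluded, adding up the classes would give [size L <= tally_bound ps L]. *)
Lemma cover_testP ps L : all (fun p => 0 < [Nat p]) ps -> cover_test ps L ->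
  forall t, exists2 d, d \in L & all (fun p => ~~ ([Nat p] %| t + [Nat d])) ps.
Proof.
have bound ps' L' t : all (fun p => 0 < [Nat p]) ps' ->
    (tally_bound ps' L' < N.of_nat (size L'))%num ->
    exists2 d, d \in L' & all (fun p => ~~ ([Nat p] %| t + [Nat d])) ps'.
  move=> pos lt; apply/hasP; case: hasP => // nogood; exfalso.
  have : size L' <= [Nat (tally_bound ps' L')]; last by lia.
  have -> : size L' = count (fun d => has (fun p => [Nat p] %| t + [Nat d]) ps') L'.
    apply/esym/eqP; rewrite -all_count; apply/allP=> d dL.
    by apply/negPn/negP; rewrite -all_predC => good; apply: nogood; exists d.
  elim: ps' pos {lt nogood} => [_|p ps' IH /andP[p0 pos]].
    by rewrite (eq_count (a2 := pred0)) ?count_pred0.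
  have -> : [Nat (tally_bound (p :: ps') L')] =
      [Nat (tally p L' (PositiveMap.empty _) 0)] + [Nat (tally_bound ps' L')].
    by rewrite /= N2Nat.inj_add.
  apply: leq_trans (leq_add (tally_count L' t p0) (IH pos)).
  by rewrite -count_predUI leq_addr.
elim: ps L => [|p ps IH] L.
  move=> pos /=; case: N.ltb_spec => // lt _ t; exact: (bound [::] L t isT lt).
move=> pos; rewrite [cover_test _ _]/=; case: N.ltb_spec => [lt _ t|_].
  exact: (bound (p :: ps) L t pos lt).
case/andP: pos => p0 pos /allP tst t.
pose r := ([Nat p] - t %% [Nat p]) %% [Nat p].
have /tst/(IH _ pos)/(_ t)[d] : r \in iota 0 [Nat p] by rewrite mem_iota ltn_mod.
rewrite mem_filter => /andP[dr dL] good; exists d => //=; rewrite good andbT.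
apply: contra dr => /(dvd_residue p0); rewrite -/r => <-.
have pN : (0 < p)%num by lia.
by have [<- _] := to_nat_divmod d pN; rewrite N2Nat.id N.eqb_refl.
Qed.

(** * Correctness of the computations in explicit fields *)

Lemma to_nat_pow p k : [Nat (p ^ N.of_nat k)] = [Nat p] ^ k.
Proof.
elim: k => [|k IH] //; rewrite Nat2N.inj_succ N.pow_succ_r' N2Nat.inj_mul IH.
by rewrite expnS.
Qed.

Lemma rlogP p cs qn b j : 
  rlog p (log_table p 0 (traject (rmulw p cs) (rone cs) qn) (PositiveMap.empty _)) b = Some j ->
  [Nat j] < qn /\ b = iter [Nat j] (rmulw p cs) (rone cs).
Proof.
rewrite /rlog; case E: PositiveMap.find => [[i c]|//]; case: eqP => // <- [<-].
case/log_tableP: E => [|[a lta [-> ->]]]; first by rewrite PositiveMap.gempty.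
rewrite size_traject in lta; rewrite N.add_0_l Nat2N.id; split=> //.
by rewrite -(nth_traject _ lta); apply: set_nth_default; rewrite size_traject.
Qed.

Lemma line_logsP p q i m bs l : line_logs p q i m bs = Some l ->
  size l = size bs /\ forall a s0, a < size bs -> exists2 j,
    rlog p m (nth s0 bs a).2 = Some j &
    nth 0%num l a = (i + N.of_nat a + (q + 1) * (q - 1 - j))%num.
Proof.
elim: bs i l => [|b bs IH] i l /=; first by case=> <-.
case E: rlog => [j|//]; case E': line_logs => [l'|//] [<-].
have [sl lE] := IH _ _ E'; split=> [|[|a] s0 lta] /=; first by rewrite sl.
  by exists j => //; rewrite N.add_0_r.
have [j' -> ->] := lE a s0 lta; exists j' => //.
by rewrite (_ : (i + 1 + N.of_nat a = i + N.of_nat a.+1)%num) //; lia.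
Qed.

(** A root is taken in a splitting field over [F]. The computed identity [w ^+ (#|F| - 1) = 1] makes
    it a fixed point of the Frobenius map of [F], so it lies in [F]. *)
Lemma exists_root_charp (F : finFieldType) p cs :
    [Nat p] \in [pchar F]%R -> 0 < size cs -> 
    iter (#|F| - 1) (rmulw p cs) (rone cs) = rone cs ->
  exists2 w : F, (w ^+ size cs = reval w cs)%R & (w ^+ (#|F| - 1) = 1)%R.
Proof.
move=> pF k0 itE.
pose P : {poly F} := ('X^(size cs) - Poly [seq ([Nat x]%:R)%R | x <- cs])%R.
have sP : size P = (size cs).+1.
  rewrite size_polyDl size_polyXn // size_polyN ltnS.
  by rewrite (leq_trans (size_Poly _)) // size_map.
have P0 : (P != 0)%R by rewrite -size_poly_eq0 sP.
have [L [rs eqrs _]] := FinSplittingFieldFor P0.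
have srs : size rs = size cs.
  have := eqp_size eqrs; rewrite size_map_poly sP size_prod_XsubC.
  by case.
case: rs srs eqrs => [|w rs] srs eqrs; first by rewrite -srs in k0.
have revE (l : seq N) (R S : fieldType) (f : {rmorphism R -> S}) (x : R) :
    f (reval x l) = reval (f x) l.
  by elim: l => [|y l IH] /=; rewrite ?rmorph0 // rmorphD rmorphM rmorph_nat IH.
have hornerE (R : fieldType) (x : R) (l : seq N) :
    ((Poly [seq ([Nat y]%:R)%R | y <- l]).[x])%R = reval x l.
  by rewrite horner_Poly; elim: l => [|y l IH] //=; rewrite IH addrC mulrC.
have wE : (w ^+ size cs = reval w cs)%R.
  have : root (map_poly (in_alg L) P) w.
    by rewrite (eqp_root eqrs) root_prod_XsubC inE eqxx.
  rewrite rootE rmorphB /= map_polyXn hornerD hornerN hornerXn subr_eq0 => /eqP ->.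
  rewrite -hornerE; congr (_.[_])%R; apply/polyP=> i; rewrite coef_map !coef_Poly.
  have [lti|gei] := ltnP i (size cs); last first.
    by rewrite !nth_default ?size_map // raddf0.
  by rewrite !(nth_map 0%num) //= scaler_nat.
have pL : [Nat p] \in [pchar L]%R by rewrite (fmorph_pchar (in_alg L)).
have wq : (w ^+ (#|F| - 1) = 1)%R.
  have [_ <-] := reval_iter pL wE k0 (#|F| - 1).
  by rewrite itE; have [_ ->] := reval1 w k0.
have /vlineP[w0 w0E] : w \in 1%AS.
  rewrite Fermat's_little_theorem dimv1 expn1; apply/eqP.
  by rewrite -{2}[w]mul1r -wq -exprSr subn1 prednK // ltnW ?finNzRing_gt1.
have inj := fmorph_inj (in_alg L).
exists w0; apply: inj.
  by rewrite rmorphXn revE /= -w0E.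
by rewrite rmorphXn /= -w0E wq scale1r.
Qed.

Lemma generator_lineP p cs D (F K : finFieldType) (emb : {rmorphism F -> K}) :
    generator_line p cs = Some D -> #|F| = [Nat (p ^ N.of_nat (size cs))] ->
    #|K| = #|F| ^ 2 ->
  exists g : K, [/\ ((#|F| ^ 2 - 1).-primitive_root g)%R,
    forall x, g != emb x,
    forall d, d \in map N.to_nat D -> exists x, (g ^+ d = g + emb x)%R
  & forall x s, (g ^+ s = g + emb x)%R ->
      exists2 d, d \in map N.to_nat D & s = d %[mod #|F| ^ 2 - 1]].
Proof.
rewrite /generator_line; set qN := (p ^ _)%num; set qn := [Nat qN].
case: ifP => // /and5P[k0 oq /N.ltb_lt p_lt /eqP pE /and3P[/eqP lasth zech /eqP lastb]].
move=> logs cF cK.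
have pp : prime [Nat p].
  have p0 : 0 < [Nat p].
    by case: (p) pE => // p' _ /=; lia.
  have [|_ inl] := @odd_factorsP p; first by rewrite p0 -mulnn; lia.
  by have := inl [Nat p]; rewrite pE inE eqxx => /esym/and3P[].
have cF' : #|F| = [Nat p] ^ size cs by rewrite -to_nat_pow cF.
have pF := card_finPcharP cF' pp.
have q1 := finNzRing_gt1 F.
have oF : odd #|F| by rewrite cF.
have two0 : (2%:R != 0 :> F)%R.
  rewrite -(dvdn_pcharf pF) dvdn_prime2 //; apply/eqP => p2.
  by move: oF; rewrite cF' p2 oddX orbF; case: (size cs) k0.
have qnE : qn = (#|F| - 1).+1 by rewrite subn1 prednK // ltnW.
have itE : iter (#|F| - 1) (rmulw p cs) (rone cs) = rone cs.
  by move: lasth; rewrite qnE trajectS last_cons last_traject.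
have [w wE w_order] := exists_root_charp pF k0 itE.
have [g g_sq] := exists_quadratic_root emb cK oF w two0.
have iterE := reval_iter pF wE k0.
pose s0 := (rzero cs, rone cs).
pose st i := iter i (bstep p cs) s0.
pose b i : F := reval w (st i).1.
have sz i : size (st i).1 = size cs /\ size (st i).2 = size cs.
  elim: i => [|i [s1 s2]]; first by rewrite /= size_nseq prednK //; split; rewrite ?size_nseq.
  rewrite /st iterS /=; split=> //.
  by have [s3 _] := reval_mulw pF wE s1; have [->] := reval_sub w pF (etrans s2 (esym s3)).
have b_0 : (b 0 = 0)%R by have [_] := reval0 cs w.
have b_1 : (b 1 = 1)%R by have [_] := reval1 w k0.
have b_rec i : (b i.+2 = b i.+1 - w * b i)%R.
  have [s1 s2] := sz i; have [s3 e3] := reval_mulw pF wE s1.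
  by have [_] := reval_sub w pF (etrans s2 (esym s3)); rewrite e3.
have stq : st #|F| = (rsub p (rzero cs) (rone cs), rzero cs).
  by move: lastb; rewrite -/s0 trajectS last_cons last_traject -/qn -cF.
have b_q : (b #|F| = -1)%R.
  rewrite /b stq /=; have [z0 e0] := reval0 cs w; have [s1 e1] := reval1 w k0.
  by have [_ ->] := reval_sub w pF (etrans z0 (esym s1)); rewrite e0 e1 sub0r.
have b_q1 : (b #|F|.+1 = 0)%R.
  by rewrite /b (_ : (st #|F|.+1).1 = (st #|F|).2) // stq /=; have [_] := reval0 cs w.
have w0 : (w != 0)%R.
  apply/eqP=> w0; move/eqP: w_order; rewrite w0 expr0n eq_sym.
  by rewrite gtn_eqF ?oner_eq0 // subn_gt0.
(* The difference [w ^+ j - 1] was found in the table of powers of [w], so it is nonzero. *)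
have w_prim j : 0 < j < #|F| - 1 -> (w ^+ j != 1)%R.
  move=> /andP[j0 jq].
  have /(allP zech) : iter j (rmulw p cs) (rone cs) \in
      take (qn - 2) (behead (traject (rmulw p cs) (rone cs) qn)).
    apply/(nthP [::]); exists j.-1.
      by rewrite size_take size_behead size_traject -cF; case: ifP; lia.
    rewrite nth_take; last by rewrite -cF; lia.
    rewrite nth_behead prednK // (set_nth_default (rone cs)); last by rewrite size_traject -cF; lia.
    by rewrite nth_traject // -cF; lia.
  case El: rlog => [i|//] _; have [_ lE] := rlogP El.
  have [s1 e1] := iterE j; have [s2 e2] := reval1 w k0.
  have [_] := reval_sub w pF (etrans s1 (esym s2)); rewrite lE e1 e2.
  have [_ ->] := iterE [Nat i] => E.
  by rewrite -subr_eq0 -E expf_neq0.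
have [sD logsE] := line_logsP logs.
have sbs : size (take qn (traject (bstep p cs) s0 qn.+1)) = #|F|.
  by rewrite size_take size_traject ltnSn -cF.
(* The state number [i - 1] is [(b (i - 1), b i)], so its second component yields entry [i - 1] of
   [D]. *)
have log_i i : 0 < i <= #|F| -> exists j, [/\ j <= #|F| - 1, (b i = w ^+ j)%R &
    i + #|F|.+1 * (#|F| - 1 - j) = [Nat (nth 0%num D i.-1)]].
  move=> /andP[i0 iq]; have [|j El nE] := logsE i.-1 s0; first by rewrite sbs; lia.
  have [jq lE] := rlogP El; exists [Nat j]; split; first by move: jq; rewrite -/qn -cF; lia.
    have [_ <-] := iterE [Nat j]; rewrite -lE nth_take; last by rewrite -/qn -cF; lia.
    rewrite nth_traject; last by rewrite -/qn -cF; lia.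
    by case: i i0 {iq nE El lE} => // i _; rewrite /b /st iterS.
  have e1 : [Nat (qN + 1)] = #|F|.+1 by rewrite cF /qn; lia.
  have e2 : [Nat (qN - 1 - j)] = #|F| - 1 - [Nat j] by rewrite cF /qn; lia.
  by rewrite nE N2Nat.inj_add N2Nat.inj_mul e1 e2; congr (_ + _); lia.
have b_pow i : 0 < i <= #|F| -> exists2 j, j <= #|F| - 1 & (b i = w ^+ j)%R.
  by move/log_i => [j [jq bj _]]; exists j.
exists g; split.
- exact: (gen_prim cK oF g_sq b_0 b_1 b_rec b_q b_q1 w_order w_prim b_pow).
- exact: (gen_out cK oF g_sq b_0 b_1 b_rec b_q b_q1 w_order w_prim).
- move=> d /(nthP 0)[a]; rewrite size_map sD sbs => lta <-.
  rewrite (nth_map 0%num) ?sD ?sbs //.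
  have [|j [jq bj <-]] := log_i a.+1; first by rewrite lta.
  exact: (line_log g_sq b_0 b_1 b_rec b_q b_q1 w_order _ jq bj).
move=> x s gs.
have [i [iq iE]] := line_log_unique cK oF g_sq b_0 b_1 b_rec b_q b_q1 w_order w_prim b_pow gs.
have [j [jq bj dE]] := log_i i iq.
exists (i + #|F|.+1 * (#|F| - 1 - j)); last exact: iE.
rewrite dE; apply: map_f; apply: mem_nth; rewrite sD sbs; lia.
Qed.

Lemma explicit_testP f : odd [Nat (field_size f)] -> 1 < [Nat (field_size f)] ->
  explicit_test f -> two_primitive_lines [Nat (field_size f)].
Proof.
move=> oq q1; rewrite /explicit_test; case E: generator_line => [D|//].
case/andP=> /N.ltb_lt q_lt /allP cover F K emb cF cK.
have [g [pg gout Dline _]] := generator_lineP emb E cF (etrans cK (congr1 (expn^~ 2) (esym cF))).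
have [|_ inl] := odd_factors_sqP oq; first by rewrite q1 -mulnn; lia.
rewrite -cF in cK inl oq *.
apply: (explicit_lines cK oq pg gout Dline
  (C := map N.to_nat (sort N.leb (odd_factors_sq (field_size f))))).
  move=> p; rewrite -inl => /mapP[x xin ->]; apply: map_f.
  by rewrite mem_sort.
(* The residue [2 + 3 * t] is [2 - t] modulo 4, as required for [t + d = 2 %[mod 4]]. *)
move=> t; have /cover/cover_testP : (2 + 3 * t) %% 4 \in iota 0 4 by rewrite mem_iota ltn_mod.
case/(_ _ t).
  apply/allP=> p; rewrite mem_sort => pin.
  by have := inl [Nat p]; rewrite map_f // => /esym/and3P[/prime_gt0].
move=> d; rewrite mem_filter => /andP[/N.eqb_eq d4 dD] good.
exists [Nat d]; first exact: map_f.
rewrite /hits all_map; apply/andP; split=> //.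
have [dE _] := @to_nat_divmod 4 d (erefl Lt).
have {}dE : [Nat d] %% 4 = (2 + 3 * t) %% 4 by rewrite -dE d4 Nat2N.id.
by rewrite /dvdn; lia.
Qed.

Lemma explicit_test_all : all explicit_test explicit_fields.
Proof. by vm_compute. Qed.

Lemma two_primitive_linesP q : odd_prime_power q ->
  q \notin [:: 3; 5; 7; 9; 11; 13; 31; 41] -> two_primitive_lines q.
Proof.
move=> oq qn; have [/hasP[x xin /N.eqb_eq qx]|//] := prime_power_lines oq.
have qE : q = [Nat x] by rewrite -qx Nat2N.id.
move: xin; rewrite mem_cat => /orP[|/mapP[f fin xE]].
  move: qn; rewrite qE !inE => /negP qn /or4P[||| /or4P[||| /orP[]]] /eqP xE;
  by case: qn; rewrite xE.
have [o [p [k [pp k0 pk]]]] := oq.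
rewrite qE xE; apply: explicit_testP; last exact: (allP explicit_test_all).
  by rewrite -xE -qE.
by rewrite -xE -qE pk -(exp1n k) ltn_exp2r ?prime_gt1.
Qed.

Local Open Scope ring_scope.

(** * Field extensions *)

(** Here [w = 12], and the odd primes are those of [41 ^ 2 - 1 = 2 ^ 4 * 3 * 5 * 7]. *)
Lemma line41_not_hit :
  if generator_line 41 [:: 12]%num is Some D then
    all (fun d => let s := (168 + d)%num in
      [|| ~~ (s mod 2 =? 0)%num, (s mod 3 =? 0)%num, (s mod 4 =? 0)%num,
          (s mod 5 =? 0)%num | (s mod 7 =? 0)%num]) D
  else false.
Proof. by vm_compute. Qed.

Lemma gcdn_eq2 n k : (0 < n)%N -> (2 %| n)%N -> (n %/ 2 = n %/ gcdn k n)%N -> gcdn k n = 2%N.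
Proof.
move=> n0 n2 oE; have q0 : (0 < n %/ 2)%N by rewrite divn_gt0 // dvdn_leq.
by apply/eqP; rewrite -(eqn_pmul2l q0) {1}oE divnK ?dvdn_gcdr // divnK.
Qed.

Section QuadraticFieldExt.

Variables (F : finFieldType) (E : fieldExtType F).
Hypothesis dimE : \dim {:E} = 2%N.

Let K : finFieldType := FinFieldExtType E.
Let emb : {rmorphism F -> K} := GRing.in_alg E.

Lemma card_quadratic_ext : #|K| = (#|F| ^ 2)%N.
Proof.
rewrite -dimE.
exact: etrans (esym (@card_vspacef F K (Vector.class E)))
  (@card_vspace F K (Vector.class E) {:E}%VS).
Qed.

Lemma notin_base (theta : E) : (theta \notin 1%VS) = [forall x : F, theta != x%:A].
Proof.
apply/idP/forallP => [th x|th].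
  by apply: contraNneq th => ->; rewrite memvZ ?mem1v.
by apply/negP => /vlineP[x]; apply/eqP.
Qed.

Lemma r_primitive2E (z : E) : odd #|F| ->
  r_primitive 2 z <-> ((#|F| ^ 2 - 1) %/ 2)%N.-primitive_root z.
Proof.
move=> oF; rewrite /r_primitive dimE; split=> [[]|]//; split=> //.
exact: dvdn_trans (_ : 2 %| 8)%N (dvd8_order oF).
Qed.

Lemma ext_lines (alpha theta : E) : two_primitive_lines #|F| -> odd #|F| ->
  alpha != 0 -> theta \notin 1%VS ->
  exists x : F, r_primitive 2 (alpha * (theta + x%:A)).
Proof.
move=> lines oF a0; rewrite notin_base => /forallP th.
have [x px] := lines F K emb erefl card_quadratic_ext alpha theta a0 th.
by exists x; apply/r_primitive2E.
Qed.

(** In dimension 2 there is no subspace strictly between the base field and the extension. *)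
Lemma adjoin_full (theta : E) :
  <<1; theta>>%VS = {:E}%VS <-> theta \notin 1%VS.
Proof.
split=> [full|th].
  apply/negP => /Fadjoin_idP full1; have := dimE.
  by rewrite -full full1 dimv1.
apply/eqP; rewrite -(geq_leqif (dimv_leqif_eq (subvf _))) dimE ltnNge.
apply: contra th => dle; suff /eqP -> : (1%VS == <<1; theta>>%VS) by exact: memv_adjoin.
by rewrite -(geq_leqif (dimv_leqif_eq (subv_adjoin _ _))) dimv1.
Qed.

(** The failing line is [alpha = g ^+ 168], [theta = g]. A 2-primitive element on it has a logarithm
    whose gcd with 1680 is 2, but the table lists all logarithms of [g + F] modulo 1680 and excludes
    this. *)
Lemma no_line_property41 : #|F| = 41%N -> ~ line_property 2 E.
Proof.
move=> cF lp; have oF : odd #|F| by rewrite cF.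
have := line41_not_hit; case gl: generator_line => [D|//] /allP noD.
have [|g [pg gout _ Duniq]] := generator_lineP emb gl _ card_quadratic_ext.
  by rewrite cF.
have g0 : g != 0 by rewrite -(rmorph0 emb) gout.
have /adjoin_full gfull : (g : E) \notin 1%VS by rewrite notin_base; apply/forallP.
have [x /(r_primitive2E _ oF) px] := lp (g ^+ 168) g (expf_neq0 _ g0) gfull.
have gx0 : g + emb x != 0 by apply: (line_neq0 gout).
have gs := dlogK card_quadratic_ext pg gx0; set s := dlog F g _ in gs.
have [d /mapP[e eD ->] sd] := Duniq x s gs.
have {}px : ((#|F| ^ 2 - 1) %/ 2)%N.-primitive_root (g ^+ (168 + s)).
  by rewrite exprD gs.
have n8 := dvd8_order oF; have n0 := order_gt0 F.
have gcd2 : gcdn (168 + s) (#|F| ^ 2 - 1) = 2%N.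
  have px' := exp_prim_root pg (168 + s).
  have oE : ((#|F| ^ 2 - 1) %/ 2 = (#|F| ^ 2 - 1) %/ gcdn (168 + s) (#|F| ^ 2 - 1))%N.
    apply/eqP; rewrite eqn_dvd (prim_order_dvd px) (prim_order_dvd px').
    by rewrite (prim_expr_order px) (prim_expr_order px') eqxx.
  exact: gcdn_eq2 n0 (dvdn_trans (isT : 2 %| 8)%N n8) oE.
have {}gcd2 : gcdn (168 + [Nat e]) (#|F| ^ 2 - 1) = 2%N.
  have sdE : (168 + [Nat e] = 168 + s %[mod #|F| ^ 2 - 1])%N.
    by rewrite -(modnDmr 168 [Nat e]) -sd modnDmr.
  by rewrite -gcdn_modl sdE gcdn_modl.
have nE : (#|F| ^ 2 - 1 = 2 ^ 4 * 3 * 5 * 7)%N by rewrite cF.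
have bad m : (m %| #|F| ^ 2 - 1)%N -> ~~ (m %| 2)%N -> ~~ (m %| 168 + [Nat e])%N.
  by move=> mn m2; apply: contra m2 => me; rewrite -gcd2 dvdn_gcd me.
have even : (2 %| 168 + [Nat e])%N.
  by have := dvdn_gcdl (168 + [Nat e]) (#|F| ^ 2 - 1)%N; rewrite gcd2.
have [b3 b4 b5 b7] : [/\ ~~ (3 %| 168 + [Nat e]), ~~ (4 %| 168 + [Nat e]),
    ~~ (5 %| 168 + [Nat e]) & ~~ (7 %| 168 + [Nat e])]%N.
  by rewrite nE in bad; split; apply: bad.
have eE : [Nat (168 + e)] = (168 + [Nat e])%N by rewrite N2Nat.inj_add.
have := noD e eD; clear -even b3 b4 b5 b7 eE; cbv beta zeta.
rewrite !to_nat_dvd // eE.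
by rewrite even (negPf b3) (negPf b4) (negPf b5) (negPf b7).
Qed.

End QuadraticFieldExt.

Lemma quadratic_ext_exists p : prime p ->
  exists E : fieldExtType 'F_p, \dim {:E} = 2%N.
Proof.
move=> pp; have [Fm pFm cFm] := pPrimePowerField pp (isT : 0 < 2)%N.
exists (pPrimeCharType pFm).
(* The dimension is recovered from the cardinality [p ^ 2]. *)
have [n cE dE] : exists2 n, #|Fm| = (p ^ n)%N & \dim {: pPrimeCharType pFm} = n.
  by eexists; [exact: (card_pprimeChar pFm) | exact: (pprimeChar_dimf pFm)].
rewrite dE; apply/eqP; rewrite -(eqn_exp2l _ _ (prime_gt1 pp)) -cE.
exact/eqP.
Qed.

Theorem theorem5 :
  (forall q : nat, odd_prime_power q ->
     q \notin [:: 3; 5; 7; 9; 11; 13; 31; 41]%N ->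
   forall (F : finFieldType) (E : fieldExtType F),
     #|F| = q -> \dim {:E} = 2%N ->
   forall alpha theta : E, alpha != 0 -> theta \notin 1%VS ->
     exists x : F, r_primitive 2 (alpha * (theta + x%:A)))
  /\ (quadratic_line_property_beyond 2 41 /\
      forall L : int, quadratic_line_property_beyond 2 L -> 41 <= L).
Proof.
have lines : forall q : nat, odd_prime_power q ->
     q \notin [:: 3; 5; 7; 9; 11; 13; 31; 41]%N ->
   forall (F : finFieldType) (E : fieldExtType F),
     #|F| = q -> \dim {:E} = 2%N ->
   forall alpha theta : E, alpha != 0 -> theta \notin 1%VS ->
     exists x : F, r_primitive 2 (alpha * (theta + x%:A)).
  move=> q oq qn F E cF dE alpha theta; apply: ext_lines => //; rewrite cF.
    exact: two_primitive_linesP.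
  by case: oq.
split=> //; split=> [q oq q41 F E cF dE alpha theta a0 full|L beyond].
  apply: (lines q oq _ F E cF dE) => //; last by apply/(adjoin_full dE).
  apply: contraL q41; rewrite -leNgt.
  by rewrite !inE => /or4P[||| /or4P[||| /orP[]]] /eqP->.
rewrite leNgt; apply/negP => L41.
have [E dE] := quadratic_ext_exists (isT : prime 41).
have c41 : #|'F_41| = 41%N by rewrite card_Fp.
apply: (no_line_property41 dE c41); apply: (beyond 41%N) => //.
by split=> //; exists 41%N, 1%N.
Qed.
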